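(* Let $(R,\mathfrak m)$ be a local ring and $M$ a Cohen-Macaulay $R$-module of dimension $d$. If $x_1,\ldots,x_i\in\mathfrak m$ is a regular sequence on $M$, then it is $H_{\mathfrak m}^d(M)$-coregular. Furthermore, for any $n\ge 1$, there is an isomorphism $$\alpha_{i,n}: H^{d-i}_{\mathfrak m}(M/(x_1^n,\ldots,x_i^n)M)\longrightarrow 0:_{H_{\mathfrak m}^d(M)}(x_1^n,\ldots,x_i^n),$$ and, for all $n\ge 1$, the following diagram is commutative: $$\begin{array}{ccc} H^{d-i}_{\mathfrak m}(M/(x_1^{n+1},\ldots,x_i^{n+1})M) & \xrightarrow{\ \alpha_{i,n+1}\ } & 0:_{H^d_{\mathfrak m}(M)}(x_1^{n+1},\ldots,x_i^{n+1})\\ {\scriptstyle \nu_n}\downarrow & & \downarrow{\scriptstyle x_1\cdots x_i}\\ H^{d-i}_{\mathfrak m}(M/(x_1^{n},\ldots,x_i^{n})M) & \xrightarrow{\ \alpha_{i,n}\ } & 0:_{H^d_{\mathfrak m}(M)}(x_1^{n},\ldots,x_i^{n}) \end{array}$$ where $\nu_n$ is the natural homomorphism (induced by the natural surjection $M/(x_1^{n+1},\ldots,x_i^{n+1})M\to M/(x_1^n,\ldots,x_i^n)M$) and the right vertical map is multiplication by $x_1\cdots x_i$.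
   Context: Local ring means commutative Noetherian local ring; Cohen-Macaulay modules are finitely generated. $H^j_{\mathfrak m}$ denotes the $j$-th local cohomology functor with respect to $\mathfrak m$. For an Artinian module $X$ over a commutative quasi-local ring $(A,\mathfrak n)$, write $0:_X(y_1,\ldots,y_k)=\{u\in X: y_1u=\cdots=y_ku=0\}$ (equal to $X$ when $k=0$). A sequence $x_1,\ldots,x_n\in\mathfrak n$ is $X$-coregular if multiplication by $x_j$ on $0:_X(x_1,\ldots,x_{j-1})$ is surjective for $j=1,\ldots,n$. *)

(* Defs.v *)
From HB Require Import structures.
From mathcomp Require Import all_boot all_order all_algebra.
From mathcomp Require Import boolp classical_sets.

Set Implicit Arguments.
Unset Strict Implicit.
Unset Printing Implicit Defensive.
Import Order.TTheory GRing.Theory Num.Theory.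
Local Open Scope ring_scope.
Local Open Scope quotient_scope.

Definition mk_linear (R : comNzRingType) (U V : lmodType R) (f : U -> V)
    (f_linear : linear f) : {linear U -> V} :=
  HB.pack f (GRing.isLinear.Build R U V *:%R f f_linear).

Section QuotientModule.
Variables (R : comNzRingType) (M : lmodType R) (S : submodClosed M).

Definition zmod_of_submod : zmodClosed M := HB.pack (fun u : M => u \in S)
  (GRing.isZmodClosed.Build M (fun u : M => u \in S)
     (GRing.submod_closedB (submodClosedP S) : GRing.zmod_closed (fun u : M => u \in S))).
Local Notation Q := (Quotient.quot zmod_of_submod).

Definition quotmod : Type := Q.
HB.instance Definition _ := GRing.Zmodule.on quotmod.

Definition qpi (u : M) : quotmod := \pi_(Q) u.

Lemma qpi_surj (q : quotmod) : exists u, q = qpi u.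
Proof. by exists (repr (q : Q)); rewrite /qpi reprK. Qed.

Lemma qpi_eq (u v : M) : (qpi u == qpi v) = (u - v \in S).
Proof.
have := Quotient.idealrBE zmod_of_submod u v.
by rewrite -topredE /= => ->.
Qed.

Lemma qpi_is_zmod_morphism : zmod_morphism qpi.
Proof. by move=> x y; rewrite /qpi; apply: raddfB. Qed.

Definition qscale (a : R) (q : quotmod) : quotmod :=
  qpi (a *: repr (q : Q)).

Lemma qscaleE a u : qscale a (qpi u) = qpi (a *: u).
Proof.
apply/eqP; rewrite qpi_eq -scalerBr rpredZ // -qpi_eq; apply/eqP.
by rewrite {1}/qpi reprK.
Qed.

Let qpiD u v : qpi (u + v) = qpi u + qpi v.
Proof. by rewrite /qpi; apply: raddfD. Qed.

Fact qscaleA a b q : qscale a (qscale b q) = qscale (a * b) q.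
Proof. by have [u ->] := qpi_surj q; rewrite !qscaleE scalerA. Qed.
Fact qscale1 : left_id 1 qscale.
Proof. by move=> q; have [u ->] := qpi_surj q; rewrite qscaleE scale1r. Qed.
Fact qscaleDr : right_distributive qscale +%R.
Proof.
move=> a q r; have [u ->] := qpi_surj q; have [v ->] := qpi_surj r.
by rewrite -qpiD !qscaleE scalerDr qpiD.
Qed.
Fact qscaleDl q : {morph qscale^~ q : a b / a + b}.
Proof.
by move=> a b; have [u ->] := qpi_surj q; rewrite !qscaleE scalerDl qpiD.
Qed.

HB.instance Definition _ := GRing.Zmodule_isLmodule.Build R quotmod
  qscaleA qscale1 qscaleDr qscaleDl.
HB.instance Definition _ :=
  GRing.isZmodMorphism.Build M quotmod qpi qpi_is_zmod_morphism.
Fact qpi_is_scalable : scalable qpi.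
Proof. by move=> a u; rewrite -qscaleE. Qed.
HB.instance Definition _ :=
  GRing.isScalable.Build R M quotmod *:%R qpi qpi_is_scalable.

Lemma qpi_eq0 (u : M) : (qpi u == 0) = (u \in S).
Proof. by rewrite -(raddf0 qpi) qpi_eq subr0. Qed.

Variables (N : lmodType R) (f : {linear M -> N}).
Definition qlift_fun (q : quotmod) : N := f (repr (q : Q)).

Hypothesis f0 : {in S, forall u, f u = 0}.

Let qlift_funE u : qlift_fun (qpi u) = f u.
Proof.
rewrite /qlift_fun; set v := repr _; apply/eqP.
rewrite -subr_eq0 -(raddfB f); apply/eqP/f0.
by rewrite -qpi_eq; apply/eqP; rewrite {1}/qpi reprK.
Qed.

Fact qlift_linear : linear qlift_fun.
Proof.
move=> a q r; have [u ->] := qpi_surj q; have [v ->] := qpi_surj r.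
by rewrite -(linearP qpi) !qlift_funE linearP.
Qed.

Definition qlift : {linear quotmod -> N} :=
  mk_linear qlift_linear.

Lemma qliftE u : qlift (qpi u) = f u. Proof. exact: qlift_funE. Qed.

End QuotientModule.
Arguments qpi {R M} S u.

Section Submodule.
Variables (R : comNzRingType) (M : lmodType R) (S : submodClosed M).

Record submodule := Submodule { smval : M; smP : smval \in S }.
HB.instance Definition _ := [isSub for smval].
HB.instance Definition _ := [Choice of submodule by <:].
HB.instance Definition _ := [SubChoice_isSubLmodule of submodule by <:].

Lemma smval0 : smval 0 = 0. Proof. exact: (linear0 val). Qed.
Lemma smval_linear : linear smval. Proof. exact: (linearP val). Qed.
HB.instance Definition _ :=
  GRing.isLinear.Build R submodule M *:%R smval smval_linear.

Variables (N : lmodType R) (f : {linear N -> M}).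
Hypothesis fS : forall u, f u \in S.

Definition corestr_fun (u : N) : submodule := Submodule (fS u).
Fact corestr_linear : linear corestr_fun.
Proof. by move=> a u v; apply: val_inj; rewrite /= linearP. Qed.
Definition corestr : {linear N -> submodule} :=
  mk_linear corestr_linear.

End Submodule.

Section KernelImageSpan.
Variables (R : comNzRingType) (M : lmodType R).

Section Ker.
Variables (N : lmodType R) (f : {linear M -> N}).
Definition kerm : {pred M} := fun u => f u == 0.
Fact kerm_closed : submod_closed kerm.
Proof.
split=> [|a u v]; first by apply/eqP; rewrite linear0.
by move=> /eqP fu /eqP fv; apply/eqP; rewrite linearP fu fv scaler0 addr0.
Qed.
HB.instance Definition _ := GRing.isSubmodClosed.Build R M kerm kerm_closed.
End Ker.

Section Img.
Variables (N : lmodType R) (f : {linear N -> M}).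
Definition imgm : {pred M} := fun u => `[< exists v, f v = u >].
Fact imgm_closed : submod_closed imgm.
Proof.
split=> [|a u v]; first by apply/asboolP; exists 0; rewrite linear0.
move=> /asboolP[x <-] /asboolP[y <-]; apply/asboolP.
by exists (a *: x + y); rewrite linearP.
Qed.
HB.instance Definition _ := GRing.isSubmodClosed.Build R M imgm imgm_closed.
End Img.

Section Span.
Variable A : set M.
Definition spanm : {pred M} := fun u => `[< exists s : seq (R * M),
  (forall p, p \in s -> A p.2) /\ u = \sum_(p <- s) p.1 *: p.2 >].
Fact spanm_closed : submod_closed spanm.
Proof.
split=> [|a u v]; first by apply/asboolP; exists [::]; rewrite big_nil.
move=> /asboolP[s [sA ->]] /asboolP[t [tA ->]]; apply/asboolP.
exists ([seq (a * p.1, p.2) | p <- s] ++ t); split.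
  move=> p; rewrite mem_cat => /orP[/mapP[q qs ->] /=|]; [exact: sA|exact: tA].
rewrite big_cat big_map scaler_sumr /=; congr (_ + _).
by apply: eq_bigr => p _; rewrite scalerA.
Qed.
HB.instance Definition _ := GRing.isSubmodClosed.Build R M spanm spanm_closed.

Lemma mem_spanm u : A u -> u \in spanm.
Proof.
move=> Au; apply/asboolP; exists [:: (1, u)].
by split=> [p|]; rewrite ?big_seq1 ?scale1r // inE => /eqP ->.
Qed.

Lemma spanm_sub (S : submodClosed M) :
  (forall u, A u -> u \in S) -> {subset spanm <= S}.
Proof.
move=> AS u /asboolP[s [sA ->]]; rewrite big_seq; apply: rpred_sum => p ps.
by apply/rpredZ/AS/sA.
Qed.
End Span.

End KernelImageSpan.

Definition injective_module (R : comNzRingType) (E : lmodType R) : Prop :=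
  forall (A B : lmodType R) (i : {linear A -> B}) (f : {linear A -> E}),
    injective i -> exists g : {linear B -> E}, forall u, g (i u) = f u.

Lemma injective_module_factor (R : comNzRingType) (E : lmodType R) :
  injective_module E ->
  forall (A B : lmodType R) (h : {linear A -> B}) (f : {linear A -> E}),
    (forall u, h u = 0 -> f u = 0) ->
    exists g : {linear B -> E}, forall u, g (h u) = f u.
Proof.
move=> injE A B h f hf; pose K : submodClosed A := kerm h.
have h0 : {in K, forall u, h u = 0} by move=> u /eqP.
have f0 : {in K, forall u, f u = 0} by move=> u /eqP /hf.
have inj : injective (qlift h0).
  move=> q r; have [u ->] := qpi_surj q; have [v ->] := qpi_surj r.
  rewrite !qliftE => e; apply/eqP; rewrite qpi_eq.
  have : h (u - v) == 0 by rewrite linearB subr_eq0; apply/eqP.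
  exact.
have [g gE] := injE _ _ _ (qlift f0) inj.
by exists g => u; have := gE (qpi K u); rewrite !qliftE.
Qed.

Record complex (R : comNzRingType) := Complex {
  cpx_obj :> nat -> lmodType R;
  cpx_d : forall n, {linear cpx_obj n -> cpx_obj n.+1};
  cpx_dd : forall n u, cpx_d n.+1 (cpx_d n u) = 0 }.
Arguments cpx_d {R} c n.

Record chain_map (R : comNzRingType) (C D : complex R) := ChainMap {
  cm_fun :> forall n, {linear C n -> D n};
  cm_comm : forall n u, cm_fun n.+1 (cpx_d C n u) = cpx_d D n (cm_fun n u) }.

Record injective_resolution (R : comNzRingType) (M : lmodType R) :=
  InjectiveResolution {
  ir_cpx :> complex R;
  ir_aug : {linear M -> ir_cpx 0%N};
  ir_injective : forall n, injective_module (ir_cpx n);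
  ir_aug_inj : injective ir_aug;
  ir_exact0 : forall u, cpx_d ir_cpx 0%N u = 0 -> exists v, ir_aug v = u;
  ir_augd : forall v, cpx_d ir_cpx 0%N (ir_aug v) = 0;
  ir_exact : forall n u, cpx_d ir_cpx n.+1 u = 0 ->
    exists v, cpx_d ir_cpx n v = u }.
Arguments ir_aug {R M} i.

Section DivisibleExtension.
Variables (A D : zmodType).
Hypothesis divD : forall (n : nat) (d : D), (0 < n)%N -> exists d', d' *+ n = d.
Local Open Scope classical_set_scope.

Let pgraph (G : set (A * D)) :=
  (forall x y, G x -> G y -> G (x - y)) /\ (forall d, G (0, d) -> d = 0).

Lemma divisible_extension (G0 : set (A * D)) : G0 (0, 0) -> pgraph G0 ->
  exists g : {additive A -> D}, forall x, G0 x -> g x.1 = x.2.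
Proof.
move=> G00 pG0; pose P G := pgraph G /\ (G !=set0 -> G0 `<=` G).
have [F FP Ftot|G [[pG GG0] Gmax]] := @Zorn_bigcup _ P.
  split; first split.
  - move=> x y [X FX Xx] [Y FY Yy].
    have [XY|YX] := Ftot _ _ FX FY.
      by exists Y => //; have [[+ _] _] := FP _ FY; apply => //; exact: XY.
    by exists X => //; have [[+ _] _] := FP _ FX; apply => //; exact: YX.
  - by move=> d [X FX Xd]; have [[_ +] _] := FP _ FX; apply.
  - move=> [x [X FX Xx]] y G0y; exists X => //.
    by have [_ +] := FP _ FX; apply => //; exists x.
have {}GG0 : G0 `<=` G.
  apply: GG0; apply: contrapT => G0'; apply: (Gmax G0).
    by split=> [x Gx|/(_ _ G00) G1]; case: G0'; [exists x|exists (0, 0)].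
  by split=> // _ x.
have G1 : G (0, 0) by exact: GG0.
case: pG => GB G_0.
have GN x : G x -> G (- x) by move=> Gx; rewrite -sub0r; exact: GB.
have GD x y : G x -> G y -> G (x + y).
  by move=> Gx Gy; rewrite -[y]opprK; apply: GB => //; exact: GN.
have GMn x n : G x -> G (x *+ n).
  by move=> Gx; elim: n => [|n IH]; rewrite ?mulr0n ?mulrS //; exact: GD.
have GMz x (n : int) : G x -> G (x *~ n).
  by case: n => n Gx; rewrite ?NegzE ?mulrNz -?pmulrn; [|apply: GN]; exact: GMn.
have pairMz (a : A) (d : D) (n : int) : (a, d) *~ n = (a *~ n, d *~ n).
  have E (k : nat) : (a, d) *+ k = (a *+ k, d *+ k).
    by elim: k => // k IH; rewrite !mulrS IH.
  by case: n => n; rewrite ?NegzE ?mulrNz -!pmulrn E.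
have Gfun a d e : G (a, d) -> G (a, e) -> d = e.
  move=> Gd Ge; apply/eqP; rewrite -subr_eq0; apply/eqP/G_0.
  have -> : (0, d - e) = (a, d) - (a, e) by rewrite -[RHS]/(a - a, d - e) subrr.
  exact: GB.
have ext a d : (forall (k : int) e, G (a *~ k, e) -> e = d *~ k) -> G (a, d).
  move=> H; apply: contrapT => nG.
  apply: (Gmax [set x | exists y (k : int), G y /\ x = y + (a, d) *~ k]).
    split=> [x Gx|]; first by exists x, 0; rewrite mulr0z addr0.
    by move=> SG; apply/nG/SG; exists (0, 0), 1; rewrite mulr1z add0r.
  split; first split.
  - move=> _ _ [x [k [Gx ->]]] [y [l [Gy ->]]].
    exists (x - y), (k - l); split; first exact: GB.
    by rewrite mulrzBr opprD addrACA.
  - move=> e [[b f] [k [Gb]]]; rewrite pairMz => -[eb ->].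
    have Gk := GN _ Gb.
    rewrite -(H k (- f)) ?subrr //.
    have -> : a *~ k = - b by apply/eqP; rewrite -addr_eq0 addrC eb.
    exact: Gk.
  - move=> _ x G0x; exists x, 0; rewrite mulr0z addr0; split=> //; exact: GG0.
have Gtot a : exists d, G (a, d).
  have [[n0 [n0_gt0 [d0 Gn0]]]|none] :=
      pselect (exists n, (0 < n)%N /\ exists d, G (a *+ n, d)); last first.
    exists 0; apply: ext => k e Gk; rewrite mul0rz.
    have k0 : k = 0.
      apply: contrapT => /eqP k0; apply: none; exists `|k|%N.
      rewrite absz_gt0 k0; split=> //.
      case: k k0 Gk => k k0 Gk; first by exists e.
      exists (- e); rewrite /= -[_ *+ _]opprK.
      by have := GN _ Gk; rewrite NegzE mulrNz -pmulrn.
    by apply: G_0; move: Gk; rewrite k0 mulr0z.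
  have ex : exists n, (0 < n)%N && `[< exists d, G (a *+ n, d) >].
    by exists n0; rewrite n0_gt0; apply/asboolP; exists d0.
  pose n := ex_minn ex.
  have [n_gt0 [d Gd] nmin] : [/\ (0 < n)%N, exists d, G (a *+ n, d) &
      forall m, (0 < m)%N -> (exists d, G (a *+ m, d)) -> (n <= m)%N].
    rewrite /n; case: ex_minnP => m /andP[m0 /asboolP mG] mmin; split=> // l l0 lG.
    by apply: mmin; rewrite l0; apply/asboolP.
  have [d' d'E] := divD d n_gt0; exists d'; apply: ext => k e Gk.
  have [q [r [kE rn r_ge0]]] : exists q r, [/\ k = q * n%:Z + r, r < n%:Z & 0 <= r].
    have nZ0 : n%:Z != 0 by case: (n) n_gt0.
    exists (k %/ n)%Z, (k %% n)%Z; rewrite -divz_eq modz_ge0 //.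
    by split=> //; have := ltz_mod k nZ0.
  have Gq : G (a *~ q *+ n, d *~ q).
    by have := GMz _ q Gd; rewrite pairMz pmulrn mulrzAC -pmulrn.
  have qE : a *~ k = a *~ q *+ n + a *~ r by rewrite kE mulrzDr mulrzA.
  have r0 : r = 0.
    have Gr : G (a *~ r, e - d *~ q).
      have -> : a *~ r = a *~ k - a *~ q *+ n by rewrite qE [X in X - _]addrC addrK.
      exact: GB Gk Gq.
    case: (r) r_ge0 rn Gr => // m _ mn Gm; apply/eqP; apply: contraLR mn => m0.
    rewrite ltz_nat -leqNgt; apply: nmin; last by exists (e - d *~ q).
    by case: (m) m0.
  rewrite qE r0 mulr0z addr0 in Gk; rewrite (Gfun _ _ _ Gk Gq) -d'E kE r0 addr0.
  by rewrite mulrC mulrzA pmulrn.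
pose g a := projT1 (cid (Gtot a)).
have gE a : G (a, g a) by rewrite /g; case: cid.
have gadd : zmod_morphism g.
  move=> x y; apply: (Gfun (x - y)) => //; exact: GB (gE x) (gE y).
pose ga : {additive A -> D} := HB.pack g (GRing.isZmodMorphism.Build A D g gadd).
exists ga => -[a d] G0x; exact: (Gfun a _ _ (gE a) (GG0 _ G0x)).
Qed.

End DivisibleExtension.

Fact rat_int_closed : GRing.zmod_closed (fun x : rat => denq x == 1).
Proof.
split=> // x y; rewrite !unfold_in => /eqP dx /eqP dy.
by rewrite -[x]divq_num_den -[y]divq_num_den dx dy !divr1 -intrB denq_int.
Qed.
Definition rat_int : zmodClosed rat := HB.pack (fun x : rat => denq x == 1)
  (GRing.isZmodClosed.Build rat (fun x : rat => denq x == 1) rat_int_closed).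
Definition QmodZ : zmodType := Quotient.quot rat_int.

Lemma QmodZ_eq0
    (x : rat) : ((\pi_(Quotient.quot rat_int) x : QmodZ) == 0) = (denq x == 1).
Proof.
rewrite -(raddf0 \pi_(Quotient.quot rat_int)) /=.
by have := Quotient.idealrBE rat_int x 0; rewrite subr0 unfold_in /= => ->.
Qed.

Lemma QmodZ_divisible (n : nat) (d : QmodZ) : (0 < n)%N -> exists d' : QmodZ, d' *+ n = d.
Proof.
move=> n0; exists (\pi_(Quotient.quot rat_int) (repr (d : Quotient.quot rat_int) / n%:R)).
rewrite -raddfMn /= -[_ / _ *+ n]mulr_natr divfK ?reprK //.
by rewrite Num.Theory.pnatr_eq0 -lt0n.
Qed.

Lemma QmodZ_separates (A : zmodType) (a : A) : a != 0 ->
  exists chi : {additive A -> QmodZ}, chi a != 0.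
Proof.
move=> a0.
have [n n_gt1 an] : exists2 n, (1 < n)%N & forall k : int, a *~ k = 0 ->
    exists q : int, k = q * n%:Z.
  have [[n0 n0P]|none] := pselect (exists n, (0 < n)%N && (a *+ n == 0)).
    have ex : exists n, (0 < n)%N && (a *+ n == 0) by exists n0.
    case: (ex_minnP ex) => n /andP[n_gt0 /eqP an] nmin; exists n.
      by case: n n_gt0 an {nmin} => [|[|n]] // _; rewrite mulr1n => /eqP /(negP a0).
    move=> k ak; exists (k %/ n)%Z; have nZ0 : n%:Z != 0 by case: (n) n_gt0.
    suff r0 : (k %% n)%Z = 0 by rewrite {1}(divz_eq k n) r0 addr0.
    have := divz_eq k n; have := modz_ge0 k nZ0; have := ltz_mod k nZ0.
    case: (k %% n)%Z => // m; rewrite ger0_norm // ltz_nat => mn _ kE.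
    apply/eqP; apply: contraLR mn => m0; rewrite -leqNgt; apply: nmin.
    rewrite lt0n m0 /= pmulrn; apply/eqP.
    have -> : Posz m = k - (k %/ n)%Z * n by rewrite {1}kE addrC addKr.
    by rewrite mulrzBr ak mulrC mulrzA -pmulrn an mul0rz subrr.
  exists 2%N => // k ak; exists 0; rewrite mul0r; apply: contrapT => /eqP k0.
  apply: none; exists `|k|%N; rewrite absz_gt0 k0 /=.
  case: k ak k0 => k ak k0; first by apply/eqP.
  by move/eqP: ak; rewrite NegzE mulrNz oppr_eq0 -pmulrn.
have nQ0 : n%:R != 0 :> rat by rewrite Num.Theory.pnatr_eq0; case: n n_gt1 {an}.
pose c : QmodZ := \pi_(Quotient.quot rat_int) (n%:R^-1).
have c0 : c != 0.
  rewrite QmodZ_eq0; apply/negP => /eqP den1.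
  have /eqP : (numq (n%:R^-1) * n%:Z)%:~R = 1 :> rat.
    rewrite intrM -[X in X * _]divr1.
    by have := divq_num_den (n%:R^-1 : rat); rewrite den1 => ->; rewrite -pmulrn mulVf.
  rewrite -[1 in X in _ == X]/(1%:~R) eqr_int => /eqP.
  move/(congr1 absz); rewrite abszM /= => /eqP; rewrite muln_eq1.
  by case: n n_gt1 {an nQ0 c den1} => [|[]] //= n _; rewrite andbF.
have cn : c *+ n = 0.
  rewrite -raddfMn /=; apply/eqP; rewrite QmodZ_eq0.
  by rewrite -[_^-1 *+ _]mulr_natr mulVf.
pose G0 (x : A * QmodZ) := exists k : int, x = (a *~ k, c *~ k).
have [||g gE] := divisible_extension QmodZ_divisible (G0 := G0).
- by exists 0.
- split=> [_ _ [k ->] [l ->]|d [k [/esym /an [q ->] ->]]].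
    by exists (k - l); rewrite !mulrzBr.
  by rewrite mulrC mulrzA -pmulrn cn mul0rz.
by exists g; rewrite (gE (a, c)) //; exists 1.
Qed.

Section CoinducedModule.
Variables (R : comNzRingType) (X : Type).

(* The product over X of copies of Hom_Z(R, Q/Z), with (a f)(s) = f (s a) *)
Record coind := Coind {
  coind_fun :> X -> R -> QmodZ;
  coind_fun_sub : forall x r s, coind_fun x (r - s) = coind_fun x r - coind_fun x s }.

HB.instance Definition _ := gen_eqMixin coind.
HB.instance Definition _ := gen_choiceMixin coind.

Lemma coind_ext (f g : coind) : (forall x r, f x r = g x r) -> f = g.
Proof.
case: f g => [f fP] [g gP] /= fg.
have {}fg : f = g by apply: funext => x; apply: funext => r.
by case: g / fg gP => gP; congr Coind; exact: Prop_irrelevance.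
Qed.

Fact coind0_sub (x : X) (r s : R) : 0 = 0 - 0 :> QmodZ. Proof. by rewrite subr0. Qed.
Definition coind0 := @Coind (fun _ _ => 0) coind0_sub.
Fact coindN_sub (f : coind) x r s : - f x (r - s) = - f x r - - f x s.
Proof. by rewrite coind_fun_sub opprD. Qed.
Definition coindN (f : coind) := @Coind (fun x r => - f x r) (coindN_sub f).
Fact coindD_sub (f g : coind) x r s :
  f x (r - s) + g x (r - s) = f x r + g x r - (f x s + g x s).
Proof. by rewrite !coind_fun_sub opprD addrACA. Qed.
Definition coindD (f g : coind) := @Coind (fun x r => f x r + g x r) (coindD_sub f g).

Fact coindA : associative coindD.
Proof. by move=> f g h; apply: coind_ext => x r /=; rewrite addrA. Qed.
Fact coindC : commutative coindD.
Proof. by move=> f g; apply: coind_ext => x r /=; rewrite addrC. Qed.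
Fact coind_add0 : left_id coind0 coindD.
Proof. by move=> f; apply: coind_ext => x r /=; rewrite add0r. Qed.
Fact coind_addN : left_inverse coind0 coindN coindD.
Proof. by move=> f; apply: coind_ext => x r /=; rewrite addNr. Qed.
HB.instance Definition _ :=
  GRing.isZmodule.Build coind coindA coindC coind_add0 coind_addN.

Fact coindZ_sub a (f : coind) x r s : f x ((r - s) * a) = f x (r * a) - f x (s * a).
Proof. by rewrite mulrBl coind_fun_sub. Qed.
Definition coindZ a (f : coind) := @Coind (fun x r => f x (r * a)) (coindZ_sub a f).
Lemma coind_funD (f : coind) x r s : f x (r + s) = f x r + f x s.
Proof.
have f0 : f x 0 = 0 by have := coind_fun_sub f x 0 0; rewrite !subrr.
have -> : r + s = r - (0 - s) by rewrite sub0r opprK.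
by rewrite !coind_fun_sub f0 sub0r opprK.
Qed.

Fact coindZA a b f : coindZ a (coindZ b f) = coindZ (a * b) f.
Proof. by apply: coind_ext => x r /=; rewrite mulrA. Qed.
Fact coindZ1 : left_id 1 coindZ.
Proof. by move=> f; apply: coind_ext => x r /=; rewrite mulr1. Qed.
Fact coindZDr : right_distributive coindZ +%R.
Proof. by move=> a f g; exact: coind_ext. Qed.
Fact coindZDl f : {morph coindZ^~ f : a b / a + b}.
Proof. by move=> a b; apply: coind_ext => x r /=; rewrite mulrDr coind_funD. Qed.
HB.instance Definition _ := GRing.Zmodule_isLmodule.Build R coind
  coindZA coindZ1 coindZDr coindZDl.

Lemma coind_injective : injective_module (coind : lmodType R).
Proof.
move=> A B i f inj.
have ext x : exists g : {additive B -> QmodZ}, forall a, g (i a) = f a x 1.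
  pose G0 (p : B * QmodZ) := exists a, p = (i a, f a x 1).
  have [||g gE] := divisible_extension QmodZ_divisible (G0 := G0).
  - by exists 0; rewrite !linear0.
  - split=> [_ _ [a ->] [b ->]|d [a [ia ->]]].
      by exists (a - b); rewrite !linearB.
    have -> : a = 0 by apply: inj; rewrite linear0 -ia.
    by rewrite linear0.
  by exists g => a; rewrite (gE (i a, f a x 1)) //; exists a.
pose g x := projT1 (cid (ext x)).
have gE x a : g x (i a) = f a x 1 by rewrite /g; case: cid.
have hsub b x r s : g x ((r - s) *: b) = g x (r *: b) - g x (s *: b).
  by rewrite scalerBl raddfB.
pose h b : coind := @Coind (fun x r => g x (r *: b)) (hsub b).
have hlin : linear (h : B -> coind).
  move=> a b c; apply: coind_ext => x r /=.
  by rewrite scalerDr raddfD scalerA.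
exists (mk_linear hlin) => a /=.
apply: coind_ext => x r /=.
by rewrite -linearZ gE linearZ /= mul1r.
Qed.

End CoinducedModule.

Lemma enough_injectives (R : comNzRingType) (M : lmodType R) :
  exists (E : lmodType R) (e : {linear M -> E}), injective_module E /\ injective e.
Proof.
pose X := {additive M -> QmodZ}.
have esub (m : M) (chi : X) (r s : R) :
    chi ((r - s) *: m) = chi (r *: m) - chi (s *: m).
  by rewrite scalerBl raddfB.
pose e m : coind R X := Coind (esub m).
have elin : linear (e : M -> coind R X).
  move=> a b c; apply: coind_ext => x r /=.
  by rewrite scalerDr raddfD scalerA.
exists (coind R X), (mk_linear elin).
split; first exact: coind_injective.
move=> u v /= uv; apply/eqP; apply: contrapT => /negP; rewrite -subr_eq0.
move=> /QmodZ_separates[chi /eqP]; apply; rewrite raddfB.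
have /(congr1 (fun f : coind R X => f chi 1)) := uv.
by rewrite /= !scale1r => ->; rewrite subrr.
Qed.

Lemma injective_resolution_exists (R : comNzRingType) (M : lmodType R) :
  exists I : injective_resolution M, True.
Proof.
pose E (N : lmodType R) := projT1 (cid (enough_injectives N)).
pose e (N : lmodType R) : {linear N -> E N} :=
  projT1 (cid (projT2 (cid (enough_injectives N)))).
have [Einj einj] : (forall N, injective_module (E N)) /\ (forall N, injective (e N)).
  by split=> N; have [] := projT2 (cid (projT2 (cid (enough_injectives N)))).
pose K := fix K n : lmodType R :=
  if n is k.+1 then quotmod (imgm (e (K k)) : submodClosed (E (K k))) else M.
pose d n : {linear E (K n) -> E (K n.+1)} :=
  [the {linear _ -> _} of e (K n.+1) \o qpi (imgm (e (K n)) : submodClosed (E (K n)))].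
have d0 n u : d n u = 0 -> exists v, e (K n) v = u.
  move=> /= du; have : qpi (imgm (e (K n)) : submodClosed (E (K n))) u = 0.
    by apply: (einj (K n.+1)); rewrite du linear0.
  by move/eqP; rewrite qpi_eq0 => /asboolP.
have de n v : d n (e (K n) v) = 0.
  rewrite /=; have -> : qpi (imgm (e (K n)) : submodClosed (E (K n))) (e (K n) v) = 0.
    by apply/eqP; rewrite qpi_eq0; apply/asboolP; exists v.
  exact: linear0.
have dd n u : d n.+1 (d n u) = 0 by exact: de.
pose C := @Complex R (fun n => E (K n)) d dd.
unshelve eexists (@InjectiveResolution R M C (e M) _ _ _ _ _) => //.
- by move=> n; exact: Einj.
- exact: einj.
- exact: (d0 0%N).
- exact: (de 0%N).
- move=> n u /d0 [v vE]; have [w wE] := qpi_surj v.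
  by exists w; rewrite -vE wE.
Qed.

Definition injres (R : comNzRingType) (M : lmodType R) : injective_resolution M :=
  projT1 (cid (injective_resolution_exists M)).

Definition lifts (R : comNzRingType) (M N : lmodType R)
    (I : injective_resolution M) (J : injective_resolution N)
    (f : {linear M -> N}) (phi : chain_map I J) : Prop :=
  forall u, phi 0%N (ir_aug I u) = ir_aug J (f u).

Lemma comparison (R : comNzRingType) (M N : lmodType R)
    (I : injective_resolution M) (J : injective_resolution N) (f : {linear M -> N}) :
  exists phi : chain_map I J, lifts f phi.
Proof.
pose inc n : {pred I n} := match n return {pred I n} with
  | 0 => imgm (ir_aug I) | k.+1 => imgm (cpx_d I k) end.
pose K n (g : {linear I n -> J n}) := forall u, u \in inc n -> cpx_d J n (g u) = 0.
have exI n u : cpx_d I n u = 0 -> u \in inc n.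
  case: n u => [|n] u du; apply/asboolP; first exact: ir_exact0 du.
  exact: ir_exact du.
have fI u : ir_aug I u = 0 -> (ir_aug J \o f) u = 0.
  move=> Iu; suff -> : u = 0 by rewrite linear0.
  by apply: (ir_aug_inj (i := I)); rewrite Iu linear0.
have [g0 g0E] := injective_module_factor (@ir_injective _ _ J 0%N) fI.
have K0 : K 0%N g0.
  by move=> u /asboolP[v <-]; rewrite g0E; exact: ir_augd.
have step n (g : {g : {linear I n -> J n} | K n g}) :
    exists h : {h : {linear I n.+1 -> J n.+1} | K n.+1 h},
      forall u, sval h (cpx_d I n u) = cpx_d J n (sval g u).
  case: g => g Kg; have dg u : cpx_d I n u = 0 -> (cpx_d J n \o g) u = 0.
    by move=> /exI /Kg.
  have [h hE] := injective_module_factor (@ir_injective _ _ J n.+1) dg.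
  suff Kh : K n.+1 h by exists (exist _ h Kh).
  by move=> u /asboolP[v <-]; rewrite hE; exact: cpx_dd.
pose G := fix G n : {g : {linear I n -> J n} | K n g} :=
  if n is k.+1 then projT1 (cid (step k (G k))) else exist _ g0 K0.
have GE n u : sval (G n.+1) (cpx_d I n u) = cpx_d J n (sval (G n) u).
  exact: projT2 (cid (step n (G n))) u.
exists (@ChainMap _ I J (fun n => sval (G n)) GE) => u; exact: g0E.
Qed.

Definition injres_map (R : comNzRingType) (M N : lmodType R) (f : {linear M -> N}) :
  chain_map (injres M) (injres N) := projT1 (cid (comparison (injres M) (injres N) f)).

Lemma injres_mapP (R : comNzRingType) (M N : lmodType R) (f : {linear M -> N}) :
  lifts f (injres_map f).
Proof. exact: projT2 (cid (comparison (injres M) (injres N) f)). Qed.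

Section Cohomology.
Variables (R : comNzRingType) (C : complex R) (n : nat).

Definition cocycles : lmodType R := submodule (kerm (cpx_d C n) : submodClosed (C n)).

Definition coboundary : {pred cocycles} := fun z =>
  match n return C n -> bool with
  | 0 => fun u => u == 0
  | k.+1 => fun u => u \in imgm (cpx_d C k)
  end (smval z).
Fact coboundary_closed : submod_closed coboundary.
Proof.
split=> [|a u v]; rewrite !unfold_in /coboundary.
  by rewrite smval0; case: n => [|k]; rewrite ?eqxx ?rpred0.
rewrite smval_linear; move: (smval u) (smval v); case: n => [|k] {}u {}v.
  by move=> /eqP -> /eqP ->; rewrite scaler0 addr0.
by move=> uB vB; apply: rpredD => //; apply: rpredZ.
Qed.
HB.instance Definition _ :=
  GRing.isSubmodClosed.Build R cocycles coboundary coboundary_closed.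

Definition cohomology : lmodType R := quotmod (coboundary : submodClosed cocycles).
Definition cohomology_class (z : cocycles) : cohomology :=
  qpi (coboundary : submodClosed cocycles) z.

End Cohomology.
Arguments cohomology_class {R C n} z.

Section CohomologyMap.
Variables (R : comNzRingType) (C D : complex R) (phi : chain_map C D) (n : nat).

Fact cocycles_map_sub (z : cocycles C n) : phi n (smval z) \in kerm (cpx_d D n).
Proof.
apply/eqP; rewrite -cm_comm; have /eqP -> : cpx_d C n (smval z) == 0 by exact: smP z.
exact: linear0.
Qed.
Definition cocycles_map : {linear cocycles C n -> cocycles D n} :=
  corestr (S := kerm (cpx_d D n))
    (f := [the {linear _ -> _} of phi n \o @smval R _ (kerm (cpx_d C n))]) cocycles_map_sub.

Fact cohomology_map_vanish : {in coboundary (C := C) (n := n), forall z,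
  (qpi (coboundary (n := n) : submodClosed (cocycles D n)) \o cocycles_map) z = 0}.
Proof.
move=> z; rewrite unfold_in => zB; apply/eqP; rewrite /= qpi_eq0 unfold_in.
move: (z) zB; rewrite /coboundary /cocycles_map /=; case: n => [|k] {}z /=.
  by move=> /eqP ->; rewrite linear0.
by move=> /asboolP[v <-]; apply/asboolP; exists (phi k v); rewrite cm_comm.
Qed.
Definition cohomology_map : {linear cohomology C n -> cohomology D n} :=
  qlift cohomology_map_vanish.

Lemma cohomology_mapE z :
  cohomology_map (cohomology_class z) = cohomology_class (cocycles_map z).
Proof. exact: qliftE. Qed.

End CohomologyMap.

Fixpoint ideal_exp (R : comNzRingType) (I : {pred R}) (k : nat) : {pred R} :=
  if k is k'.+1 then
    @spanm R R^o [set r | exists a b, [/\ a \in I, b \in ideal_exp I k' & r = a * b]]%classic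
  else predT.

Lemma ideal_expMl (R : comNzRingType) (I : {pred R}) k r s :
  s \in ideal_exp I k -> r * s \in ideal_exp I k.
Proof. by case: k => // k sI; exact: (@rpredZ _ _ (@spanm R R^o _)). Qed.

Lemma ideal_exp_le (R : comNzRingType) (I : {pred R}) k l :
  (k <= l)%N -> {subset ideal_exp I l <= ideal_exp I k}.
Proof.
elim: l k => [|l IH] [|k] // kl.
apply: (spanm_sub (M := R^o) (S := @spanm R R^o _)) => _ [a [b [aI bI ->]]].
by apply: mem_spanm; exists a, b; split=> //; exact: IH bI.
Qed.

Section Torsion.
Variables (R : comNzRingType) (I : {pred R}).

Definition torsion (M : lmodType R) : {pred M} :=
  fun u => `[< exists k, forall r, r \in ideal_exp I k -> r *: u = 0 >].
Arguments torsion M : clear implicits.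
Fact torsion_closed M : submod_closed (torsion M).
Proof.
split=> [|a u v]; first by apply/asboolP; exists 0%N => r _; rewrite scaler0.
move=> /asboolP[k ku] /asboolP[l lv]; apply/asboolP; exists (maxn k l) => r rI.
rewrite scalerDr scalerA mulrC -scalerA ku ?lv ?scaler0 ?addr0 //.
  exact: ideal_exp_le (leq_maxr k l) _ rI.
exact: ideal_exp_le (leq_maxl k l) _ rI.
Qed.
HB.instance Definition _ M :=
  GRing.isSubmodClosed.Build R M (torsion M) (torsion_closed M).

Definition Gamma (M : lmodType R) : lmodType R :=
  submodule (torsion M : submodClosed M).

Fact Gamma_map_sub (M N : lmodType R) (f : {linear M -> N}) (z : Gamma M) :
  f (smval z) \in torsion N.
Proof.
have /asboolP[k ku] : smval z \in torsion M by exact: smP z.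
by apply/asboolP; exists k => r /ku e; rewrite -linearZ e linear0.
Qed.
Definition Gamma_map (M N : lmodType R) (f : {linear M -> N}) :
    {linear Gamma M -> Gamma N} :=
  corestr (S := torsion N)
    (f := [the {linear _ -> _} of f \o @smval R M (torsion M)]) (Gamma_map_sub f).

Fact Gamma_cpx_dd (C : complex R) n (z : Gamma (C n)) :
  Gamma_map (cpx_d C n.+1) (Gamma_map (cpx_d C n) z) = 0.
Proof. by apply: val_inj; rewrite [RHS]smval0 /= cpx_dd. Qed.
Definition Gamma_cpx (C : complex R) : complex R :=
  @Complex R (fun n => Gamma (C n)) (fun n => Gamma_map (cpx_d C n))
    (@Gamma_cpx_dd C).

Fact Gamma_cpx_map_comm (C D : complex R) (phi : chain_map C D) n (z : Gamma (C n)) :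
  Gamma_map (phi n.+1) (Gamma_map (cpx_d C n) z) =
  Gamma_map (cpx_d D n) (Gamma_map (phi n) z).
Proof. by apply: val_inj; rewrite /= cm_comm. Qed.
Definition Gamma_cpx_map (C D : complex R) (phi : chain_map C D) :
    chain_map (Gamma_cpx C) (Gamma_cpx D) :=
  @ChainMap R (Gamma_cpx C) (Gamma_cpx D) (fun n => Gamma_map (phi n))
    (@Gamma_cpx_map_comm C D phi).

(* Right derived functors of [Gamma]: apply [Gamma] to the chosen injective
   resolutions, and to a chosen lift of the map, then take cohomology. *)
Definition local_cohomology (j : nat) (M : lmodType R) : lmodType R :=
  cohomology (Gamma_cpx (injres M)) j.

Definition local_cohomology_map (j : nat) (M N : lmodType R) (f : {linear M -> N}) :
    {linear local_cohomology j M -> local_cohomology j N} :=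
  cohomology_map (Gamma_cpx_map (injres_map f)) j.

End Torsion.

Section Ideals.
Variable R : comNzRingType.
Implicit Types (I J p m : {pred R}).

(* [idealr_closed] already requires the ideal to be proper *)
Definition prime_ideal p : Prop := idealr_closed p /\ prime_idealr_closed p.

Definition maximal_ideal m : Prop := idealr_closed m /\
  forall J, idealr_closed J -> {subset m <= J} -> J =i m.

Definition local_ring m : Prop :=
  maximal_ideal m /\ forall J, maximal_ideal J -> J =i m.

Definition finitely_generated (M : lmodType R) : Prop :=
  exists s : seq M, forall u, u \in spanm [set` s]%classic.

(* The unit ideal, excluded by [idealr_closed], is always principal *)
Definition noetherian_ring : Prop := forall I, idealr_closed I ->
  exists s : seq R, forall r, (r \in I) = (r \in @spanm R R^o [set` s]%classic).

End Ideals.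
Arguments noetherian_ring R : clear implicits.

Section Modules.
Variables (R : comNzRingType) (M : lmodType R).
Implicit Types (m : {pred R}) (xs : seq R).

Definition prime_chain (p : nat -> {pred R}) (l : nat) : Prop :=
  (forall k, (k <= l)%N -> prime_ideal (p k) /\
     forall r, (forall u : M, r *: u = 0) -> r \in p k) /\
  (forall k, (k < l)%N -> {subset p k <= p k.+1} /\ ~ {subset p k.+1 <= p k}).

(* The Krull dimension of R / Ann M; it forces M <> 0, since a chain of length
   d >= 0 provides a proper ideal containing Ann M. *)
Definition krull_dim (d : nat) : Prop :=
  (exists p, prime_chain p d) /\ (forall p l, prime_chain p l -> (l <= d)%N).

Definition ideal_smul xs : {pred M} :=
  spanm [set v | exists x u, x \in xs /\ v = x *: u]%classic.
HB.instance Definition _ xs := GRing.SubmodClosed.on (ideal_smul xs).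

Definition quot_seq xs : lmodType R :=
  quotmod (ideal_smul xs : submodClosed M).

Definition annihilated xs : {pred M} := fun u => all (fun x => x *: u == 0) xs.
Fact annihilated_closed xs : submod_closed (annihilated xs).
Proof.
split=> [|a u v]; first by apply/allP => x _; rewrite scaler0.
move=> /allP xu /allP xv; apply/allP => x xxs.
rewrite scalerDr scalerA mulrC -scalerA (eqP (xu x xxs)) (eqP (xv x xxs)).
by rewrite scaler0 addr0.
Qed.
HB.instance Definition _ xs :=
  GRing.isSubmodClosed.Build R M (annihilated xs) (annihilated_closed xs).
Definition ann_seq xs : lmodType R :=
  submodule (annihilated xs : submodClosed M).

Definition coregular_seq xs : Prop := forall j, (j < size xs)%N ->
  forall v, v \in annihilated (take j xs) ->
    exists2 u, u \in annihilated (take j xs) & xs`_j *: u = v.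

End Modules.

Arguments ideal_smul {R} M xs.
Arguments annihilated {R} M xs.

Definition regular_seq (R : comNzRingType) (M : lmodType R) (xs : seq R) : Prop :=
  (forall j, (j < size xs)%N ->
     injective (fun u : quot_seq M (take j xs) => xs`_j *: u)) /\
  (exists u : quot_seq M xs, u != 0).

Section CohenMacaulay.
Variables (R : comNzRingType) (m : {pred R}) (M : lmodType R).

Definition depth (d : nat) : Prop :=
  (exists xs, [/\ {subset xs <= m}, regular_seq M xs & size xs = d]) /\
  (forall xs, {subset xs <= m} -> regular_seq M xs -> (size xs <= d)%N).

Definition cohen_macaulay : Prop :=
  finitely_generated M /\ exists2 d, krull_dim M d & depth d.

End CohenMacaulay.

Section NaturalSurjection.
Variables (R : comNzRingType) (M : lmodType R).

Definition pow_seq (xs : seq R) (n : nat) : seq R := [seq x ^+ n | x <- xs].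

Variables (xs : seq R) (n : nat).

Fact quot_pow_vanish : {in ideal_smul M (pow_seq xs n.+1), forall u,
  qpi (ideal_smul M (pow_seq xs n) : submodClosed M) u = 0}.
Proof.
move=> u uS; apply/eqP; rewrite qpi_eq0; move: u uS.
apply: (spanm_sub (S := ideal_smul M (pow_seq xs n))) => _ [y [v [/mapP[x xxs ->] ->]]].
rewrite exprSr -scalerA; apply: mem_spanm; exists (x ^+ n), (x *: v).
by split=> //; apply: map_f.
Qed.

Definition quot_pow_surj :
    {linear quot_seq M (pow_seq xs n.+1) -> quot_seq M (pow_seq xs n)} :=
  qlift quot_pow_vanish.

Lemma quot_pow_surjE u :
  quot_pow_surj (qpi (ideal_smul M (pow_seq xs n.+1) : submodClosed M) u) =
  qpi (ideal_smul M (pow_seq xs n) : submodClosed M) u.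
Proof. exact: qliftE. Qed.

End NaturalSurjection.

Section AnnihilatorMultiplication.
Variables (R : comNzRingType) (X : lmodType R) (xs : seq R) (n : nat).

Fact ann_mul_sub (u : ann_seq X (pow_seq xs n.+1)) :
  (\prod_(y <- xs) y) *: smval u \in annihilated X (pow_seq xs n).
Proof.
have /allP u0 : smval u \in annihilated X (pow_seq xs n.+1) by exact: smP u.
apply/allP => _ /mapP[y yxs ->].
have /eqP yu : y ^+ n.+1 *: smval u == 0 by apply: u0; apply: map_f.
rewrite (perm_big _ (perm_to_rem yxs)) big_cons /= scalerA mulrA -exprSr.
by rewrite mulrC -scalerA yu scaler0.
Qed.
Fact ann_mul_linear :
  linear (fun u : ann_seq X (pow_seq xs n.+1) => (\prod_(y <- xs) y) *: smval u).
Proof.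
by move=> a u v; rewrite smval_linear scalerDr !scalerA [_ * a]mulrC.
Qed.

Definition ann_mul :
    {linear ann_seq X (pow_seq xs n.+1) -> ann_seq X (pow_seq xs n)} :=
  corestr (S := annihilated X (pow_seq xs n)) (f := mk_linear ann_mul_linear)
    ann_mul_sub.

Lemma ann_mulE u : smval (ann_mul u) = (\prod_(y <- xs) y) *: smval u.
Proof. by []. Qed.

End AnnihilatorMultiplication.

(* Main.v *)
Require Import Defs.
From HB Require Import structures.
From mathcomp Require Import all_boot all_order all_algebra.
From mathcomp Require Import boolp classical_sets.
From mathcomp Require Import ring.

Set Implicit Arguments.
Unset Strict Implicit.
Unset Printing Implicit Defensive.
Import Order.TTheory GRing.Theory Num.Theory.
Local Open Scope ring_scope.

(** If [y] is a nonzerodivisor on [M], the long exact sequence of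
    [0 -> M -> M -> M / y M -> 0], whose first map is multiplication by [y],
    makes the connecting map send [H^(D-1)(M / y M)] into the kernel of [y] on
    [H^D(M)].  When [H^(D-1)(M) = 0] this is an isomorphism, and [M / y M] again
    has no cohomology below degree [D-1].  So, for a sequence, the composite of
    the connecting maps of the successive quotients is an isomorphism onto the
    elements killed by the whole sequence ([iterated_connecting_bij]).  For the
    powers [x ^+ n], the diagram commutes because connecting maps are natural
    ([connecting_natural]): the pair ([x], identity) maps multiplication by
    [x ^+ n.+1] to multiplication by [x ^+ n], and each element of the sequence
    contributes its factor [x] ([iterated_connecting_natural]).

    For a Cohen-Macaulay module of dimension [d], there is a regular sequence of
    length [d] in [m], and this makes [H^k(M)] vanish for [k < d]: the first
    element acts injectively on [H^k(M)], which consists of elements killed by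
    its powers ([lc_zero_weakly_regular]).

    Coregularity needs vanishing at the other end: multiplication by [x] on
    [H^d(M)] is surjective because [H^d(M / x M) = 0], the dimension of [M / x M]
    being smaller than [d] ([dim_lt_quot1]).  This is Grothendieck's vanishing
    theorem ([lc_zero_dim]).  Its proof reduces to cyclic modules, and then, by
    Noetherian induction on the annihilator, to a module killed by [m]; there
    positive cohomology vanishes because over a Noetherian ring a torsion module
    embeds in a torsion injective module ([torsion_embedding], which rests on
    Baer's criterion and the principal case of the Artin-Rees lemma).

    Everything is computed on elements of injective resolutions.  For a short
    exact sequence, resolutions of the two ends and a map [t] of degree 1
    between them representing the extension give the horseshoe resolution of
    the middle term; the connecting map is induced by [t], and it is natural
    because [t] is unique up to homotopy. *)

(** * Chain maps between injective resolutions *)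

Section Homotopy.
Variables (R : comNzRingType) (C N : lmodType R).
Variables (K : injective_resolution C) (J : injective_resolution N).

(** A null homotopy, built one degree at a time: what [D] does to a cocycle of
    positive degree is a coboundary through a linear map, so that torsion
    cocycles are sent to coboundaries of torsion elements.  The auxiliary [g] is
    the part of [D] already accounted for by the previous degree. *)
Lemma null_homotopy (D : chain_map K J) : (forall u, D 0%N (ir_aug K u) = 0) ->
  (forall z, cpx_d K 0%N z = 0 -> D 0%N z = 0) /\
  forall n, exists h : {linear K n.+1 -> J n},
    forall z, cpx_d K n.+1 z = 0 -> D n.+1 z = cpx_d J n (h z).
Proof.
move=> Deps.
have D0 z : cpx_d K 0%N z = 0 -> D 0%N z = 0.
  by move=> /ir_exact0[v <-].
split=> //.
pose P n (h : {linear K n.+1 -> J n}) := exists g : {linear K n -> J n},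
  (forall z, h (cpx_d K n z) = D n z - g z) /\ (forall z, cpx_d J n (g z) = 0).
have step n h : P n h -> exists2 h', P n.+1 h' &
    forall z, h' (cpx_d K n.+1 z) = D n.+1 z - cpx_d J n (h z).
  move=> [g [hg dg]]; pose dh := [the {linear _ -> _} of cpx_d J n \o h].
  have [z /ir_exact[w <-]|h' hE] := injective_module_factor
      (@ir_injective _ _ J n.+1) (h := cpx_d K n.+1)
      (f := (D n.+1 \- dh : {linear K n.+1 -> J n.+1})).
    by rewrite /= hg linearB dg subr0 cm_comm subrr.
  exists h' => //; exists dh; split=> [z|z]; first by rewrite hE.
  exact: cpx_dd.
have exh : forall n, exists h, P n h.
  elim=> [|n [h /step[h' Ph' _]]]; last by exists h'.
  have [z /D0|h hE] := injective_module_factor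
      (@ir_injective _ _ J 0%N) (h := cpx_d K 0%N) (f := D 0%N) => //.
  exists h, (\0 : {linear K 0%N -> J 0%N}); split=> z; last exact: linear0.
  by rewrite hE subr0.
move=> n; have [h Ph] := exh n; exists h => z dz.
have [h' _ h'E] := step _ _ Ph.
by apply/eqP; rewrite -subr_eq0 -h'E dz linear0.
Qed.

Fact sub_cm_comm (phi psi : chain_map K J) n u :
  (phi n.+1 \- psi n.+1) (cpx_d K n u) = cpx_d J n ((phi n \- psi n) u).
Proof. by rewrite /= !cm_comm linearB. Qed.
Definition sub_cm (phi psi : chain_map K J) : chain_map K J :=
  @ChainMap R K J (fun n => phi n \- psi n : {linear K n -> J n})
    (sub_cm_comm phi psi).

End Homotopy.

Section ChainMaps.
Variable R : comNzRingType.
Implicit Types C D E : complex R.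

Definition id_cm C : chain_map C C :=
  @ChainMap R C C (fun n => idfun : {linear C n -> C n}) (fun n u => erefl).

Fact comp_cm_comm C D E (psi : chain_map D E) (phi : chain_map C D) n u :
  (psi n.+1 \o phi n.+1) (cpx_d C n u) = cpx_d E n ((psi n \o phi n) u).
Proof. by rewrite /= !cm_comm. Qed.
Definition comp_cm C D E (psi : chain_map D E) (phi : chain_map C D) :
    chain_map C E :=
  @ChainMap R C E (fun n => [the {linear _ -> _} of psi n \o phi n])
    (comp_cm_comm psi phi).

Fact scale_cm_comm C D a (phi : chain_map C D) n u :
  (a \*: phi n.+1) (cpx_d C n u) = cpx_d D n ((a \*: phi n) u).
Proof. by rewrite /= !cm_comm linearZ. Qed.
Definition scale_cm C D a (phi : chain_map C D) : chain_map C D :=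
  @ChainMap R C D (fun n => a \*: phi n : {linear C n -> D n})
    (scale_cm_comm a phi).

Lemma lifts_comp (M N P : lmodType R) (I : injective_resolution M)
    (J : injective_resolution N) (K : injective_resolution P)
    (f : {linear M -> N}) (g : {linear N -> P}) (h : {linear M -> P})
    (phi : chain_map I J) (psi : chain_map J K) :
  lifts f phi -> lifts g psi -> (forall u, h u = g (f u)) ->
  lifts h (comp_cm psi phi).
Proof. by move=> fphi gpsi hE u; rewrite /= fphi gpsi hE. Qed.

End ChainMaps.

(** * Classes of torsion cocycles *)

Section Classes.
Variables (R : comNzRingType) (m : {pred R}).
Implicit Types C D : complex R.

Lemma torsionP (M : lmodType R) (u : M) :
  reflect (exists k, forall r, r \in ideal_exp m k -> r *: u = 0)
          (u \in @torsion _ m _).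
Proof. exact: asboolP. Qed.

Lemma torsion_linear (M N : lmodType R) (f : {linear M -> N}) u :
  u \in @torsion _ m _ -> f u \in @torsion _ m _.
Proof.
move=> /torsionP[k ku]; apply/torsionP; exists k => r /ku e.
by rewrite -linearZ e linear0.
Qed.

Definition tcocycle C n (z : C n) := z \in @torsion _ m _ /\ cpx_d C n z = 0.

Definition tboundary C n : C n -> Prop :=
  match n return C n -> Prop with
  | 0 => fun z => z = 0
  | k.+1 => fun z => exists2 w, w \in @torsion _ m _ & cpx_d C k w = z
  end.

(** Elements of the cohomology of [Gamma_cpx m C] are handled through the
    elements of [C] that represent them: this spares the two layers of
    subtypes and the quotient in the definition of cohomology. *)
Definition represents C n (z : C n) (c : cohomology (Gamma_cpx m C) n) :=
  exists2 w : cocycles (Gamma_cpx m C) n,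
    smval (smval w) = z & cohomology_class w = c.

Lemma represents_cocycle C n (z : C n) c : represents z c -> tcocycle z.
Proof.
move=> [w <- _]; split; first exact: smP (smval w).
have /eqP/(congr1 (@smval _ _ _)) : cpx_d (Gamma_cpx m C) n (smval w) == 0.
  exact: smP w.
by rewrite smval0.
Qed.

Lemma represents_ex C n (c : cohomology (Gamma_cpx m C) n) :
  exists z : C n, represents z c.
Proof. by have [w ->] := qpi_surj c; exists (smval (smval w)), w. Qed.

Lemma cocycle_represents C n (z : C n) :
  tcocycle z -> exists c, represents z c.
Proof.
move=> [zt dz].
have wP : (Submodule zt : Gamma_cpx m C n) \in kerm (cpx_d (Gamma_cpx m C) n).
  by apply/eqP; apply: val_inj; rewrite [RHS]smval0.
by exists (cohomology_class (Submodule wP)), (Submodule wP).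
Qed.

Lemma represents_uniq C n (z : C n) c c' :
  represents z c -> represents z c' -> c = c'.
Proof.
move=> [w <- <-] [w' e <-]; congr (cohomology_class _).
by do 2![apply: val_inj => /=].
Qed.

Lemma represents_linear C n a (z z' : C n) c c' :
  represents z c -> represents z' c' -> represents (a *: z + z') (a *: c + c').
Proof.
move=> [w <- <-] [w' <- <-]; exists (a *: w + w'); last exact: linearP.
by rewrite !smval_linear.
Qed.

Lemma represents0 C n (z : C n) : represents z 0 <-> tboundary z.
Proof.
have zero (w : cocycles (Gamma_cpx m C) n) :
    cohomology_class w = 0 <-> tboundary (smval (smval w)).
  apply: (iff_trans (rwP eqP)); rewrite /cohomology_class qpi_eq0 unfold_in.
  move: (smval w); clear w z; case: n => [|n] w.
    split=> [/eqP ->|w0]; first exact: smval0.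
    by apply/eqP/val_inj; rewrite [LHS]w0 [RHS]smval0.
  split=> [/asboolP[v <-]|[v vt vE]]; first by exists (smval v) => //; exact: smP.
  apply/asboolP; exists (Submodule vt : Gamma_cpx m C n).
  exact: val_inj.
split=> [[w <- /zero]|] // zb.
have zc : tcocycle z.
  case: n z zb {zero} => [z ->|n z [w wt <-]]; split; rewrite ?linear0 ?rpred0 //.
    exact: torsion_linear.
  exact: cpx_dd.
have [c [w wz wc]] := cocycle_represents zc.
by exists w => //; apply/zero; rewrite wz.
Qed.

Lemma representsB C n (z z' : C n) c c' :
  represents z c -> represents z' c' -> c = c' <-> tboundary (z - z').
Proof.
move=> zc z'c'; have := represents_linear (-1) z'c' zc.
rewrite !scaleN1r ![- _ + _]addrC => r; split=> [e|/represents0 e].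
  by apply/represents0; move: r; rewrite e subrr.
by apply/eqP; rewrite -subr_eq0; apply/eqP/(represents_uniq r).
Qed.

(** Maps of complexes of any degree induce maps in cohomology: both the maps
    of local cohomology (degree 0) and the connecting maps (degree 1) arise so. *)
Lemma induced_map C D n k (f : {linear C n -> D k}) :
  (forall z, tcocycle z -> tcocycle (f z)) ->
  (forall z, tboundary z -> tboundary (f z)) ->
  exists F : {linear cohomology (Gamma_cpx m C) n -> cohomology (Gamma_cpx m D) k},
    forall z c, represents z c -> represents (f z) (F c).
Proof.
move=> fz fb.
have ex c : exists c' : cohomology (Gamma_cpx m D) k,
    forall z, represents z c -> represents (f z) c'.
  have [z zc] := represents_ex c.
  have [c' fc'] := cocycle_represents (fz _ (represents_cocycle zc)).
  exists c' => z' z'c; have [c'' fc''] := cocycle_represents (fz _ (represents_cocycle z'c)).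
  suff -> : c' = c'' by [].
  by apply/(representsB fc' fc''); rewrite -linearB; apply/fb/(representsB zc z'c).
pose F c := projT1 (cid (ex c)).
have FE c z : represents z c -> represents (f z) (F c).
  exact: projT2 (cid (ex c)) z.
have F_linear : linear F.
  move=> a c c'; have [z zc] := represents_ex c; have [z' zc'] := represents_ex c'.
  apply: (represents_uniq (FE _ _ (represents_linear a zc zc'))).
  by rewrite linearP; apply: represents_linear; exact: FE.
by exists (mk_linear F_linear) => z c; exact: FE.
Qed.

Lemma represents_map C D (phi : chain_map C D) n z c :
  represents z c ->
  represents (phi n z) (cohomology_map (Gamma_cpx_map m phi) n c).
Proof.
move=> [w <- <-]; rewrite cohomology_mapE.
by exists (cocycles_map (Gamma_cpx_map m phi) n w).
Qed.

Lemma tboundary_map C D (phi : chain_map C D) n (z : C n) :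
  tboundary z -> tboundary (phi n z).
Proof.
case: n z => [z ->|n z [w wt <-]]; first exact: linear0.
by exists (phi n w); [exact: torsion_linear | rewrite cm_comm].
Qed.

Lemma tcocycle_map C D (phi : chain_map C D) n (z : C n) :
  tcocycle z -> tcocycle (phi n z).
Proof.
by move=> [zt dz]; split; [exact: torsion_linear | rewrite -cm_comm dz linear0].
Qed.

Lemma tboundaryD C n a (z z' : C n) :
  tboundary z -> tboundary z' -> tboundary (a *: z + z').
Proof.
move=> /represents0 z0 /represents0 z0'; apply/represents0.
by have := represents_linear a z0 z0'; rewrite scaler0 addr0.
Qed.

Lemma tboundary_eq C n (z z' : C n) :
  tboundary (z - z') -> tboundary z <-> tboundary z'.
Proof.
move=> zz'; split=> b; last by have := tboundaryD 1 zz' b; rewrite scale1r subrK.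
by have := tboundaryD (-1) zz' b; rewrite scaleN1r opprB subrK.
Qed.

Lemma lifts_tboundary (M N : lmodType R) (I : injective_resolution M)
    (J : injective_resolution N) (f : {linear M -> N}) (phi psi : chain_map I J) :
  lifts f phi -> lifts f psi ->
  forall n (z : I n), tcocycle z -> tboundary (phi n z - psi n z).
Proof.
move=> lphi lpsi.
have [|H0 Hn] := @null_homotopy _ _ _ I J (sub_cm phi psi).
  by move=> u; rewrite /= lphi lpsi subrr.
case=> [|n] z [zt dz]; first exact: H0.
have [h hE] := Hn n; exists (h z); first exact: torsion_linear.
by rewrite -hE.
Qed.

End Classes.

(** * Functoriality of local cohomology *)

Section Functoriality.
Variables (R : comNzRingType) (m : {pred R}).

(** [local_cohomology_map] depends on a chosen lift, but any lift computes it. *)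
Lemma local_cohomology_mapP n (M N : lmodType R) (f : {linear M -> N})
    (phi : chain_map (injres M) (injres N)) z
    (c : local_cohomology m n M) :
  lifts f phi -> represents z c ->
  represents (phi n z) (local_cohomology_map m n f c).
Proof.
move=> fphi zc; have := represents_map (injres_map f) zc.
have zz := represents_cocycle zc.
have [c' c'E] := cocycle_represents (tcocycle_map phi zz).
move=> c''E; suff -> : local_cohomology_map m n f c = c' by [].
apply/(representsB c''E c'E); apply: lifts_tboundary zz => //.
exact: injres_mapP.
Qed.

Lemma local_cohomology_map_eq n (M N : lmodType R) (f : {linear M -> N})
    (phi : chain_map (injres M) (injres N)) (c : local_cohomology m n M) c' z :
  lifts f phi -> represents z c -> represents (phi n z) c' ->
  local_cohomology_map m n f c = c'.
Proof.
by move=> fphi zc; apply/represents_uniq/local_cohomology_mapP.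
Qed.

Lemma local_cohomology_map_id n (M : lmodType R) (f : {linear M -> M}) c :
  f =1 id -> local_cohomology_map m n f c = c.
Proof.
move=> fid; have [z zc] := represents_ex c.
by apply: (@local_cohomology_map_eq _ _ _ _ (id_cm _) _ _ z) => // u; rewrite fid.
Qed.

Lemma local_cohomology_map_comp n (M N P : lmodType R) (g : {linear N -> P})
    (f : {linear M -> N}) (h : {linear M -> P}) c :
  (forall u, h u = g (f u)) ->
  local_cohomology_map m n h c =
  local_cohomology_map m n g (local_cohomology_map m n f c).
Proof.
move=> hE; have [z zc] := represents_ex c.
apply: (@local_cohomology_map_eq _ _ _ _
          (comp_cm (injres_map g) (injres_map f)) _ _ z) => //.
  exact: lifts_comp (injres_mapP f) (injres_mapP g) hE.
have fzc := represents_map (injres_map f) zc.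
exact: (represents_map (injres_map g) fzc).
Qed.

Lemma local_cohomology_map_scale n (M N : lmodType R) a (f h : {linear M -> N}) c :
  (forall u, h u = a *: f u) ->
  local_cohomology_map m n h c = a *: local_cohomology_map m n f c.
Proof.
move=> hE; have [z zc] := represents_ex c.
apply: (@local_cohomology_map_eq _ _ _ _ (scale_cm a (injres_map f)) _ _ z) => //.
  by move=> u; rewrite /= injres_mapP hE linearZ.
have r0 : represents (0 : injres N n) (0 : cohomology (Gamma_cpx m (injres N)) n).
  by apply/represents0; case: (n) => //= k; exists 0; rewrite ?rpred0 ?linear0.
by have := represents_linear a (represents_map (injres_map f) zc) r0; rewrite !addr0.
Qed.

End Functoriality.

(** * Connecting homomorphisms and the long exact sequence *)

Definition short_exact (R : comNzRingType) (A B C : lmodType R)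
    (i : {linear A -> B}) (p : {linear B -> C}) : Prop :=
  [/\ injective i, forall c, exists b, p b = c, forall a, p (i a) = 0 &
      forall b, p b = 0 -> exists a, i a = b].

Lemma factor_surjection (R : comNzRingType) (B C X : lmodType R)
    (p : {linear B -> C}) (f : {linear B -> X}) :
  (forall c, exists b, p b = c) -> (forall b, p b = 0 -> f b = 0) ->
  exists g : {linear C -> X}, forall b, g (p b) = f b.
Proof.
move=> p_surj f0; pose pre c := projT1 (cid (p_surj c)).
have preE c : p (pre c) = c by rewrite /pre; case: cid.
have gp b : f (pre (p b)) = f b.
  by apply/eqP; rewrite -subr_eq0 -linearB f0 // linearB preE subrr.
have g_linear : linear (fun c => f (pre c)).
  move=> a c c'.
  by rewrite -{1}[c]preE -{1}[c']preE -(linearP p) gp linearP.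
by exists (mk_linear g_linear).
Qed.

Section Shift.
Variables (R : comNzRingType) (A : lmodType R) (I : injective_resolution A).

Fact neg_shift_dd n u : (\- cpx_d I n.+2) ((\- cpx_d I n.+1) u) = 0.
Proof. by rewrite /= linearN opprK cpx_dd. Qed.
Definition neg_shift : complex R :=
  @Complex R (fun n => I n.+1)
    (fun n => \- cpx_d I n.+1 : {linear I n.+1 -> I n.+2}) neg_shift_dd.

Let Z : submodClosed (I 1%N) := kerm (cpx_d I 1%N).

(** The shift of a resolution resolves the first cosyzygy.  The sign makes maps
    into it anticommute with the differentials, as the differential of the
    horseshoe resolution below requires. *)
Definition neg_shift_resolution : injective_resolution (submodule Z).
Proof.
unshelve eexists neg_shift [the {linear _ -> _} of @smval R _ Z].
- by move=> n; exact: ir_injective.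
- exact: val_inj.
- move=> u /eqP; rewrite /= oppr_eq0 => du.
  by exists (Submodule (du : u \in Z)).
- by move=> v; apply/eqP; rewrite /= oppr_eq0; exact: smP v.
- move=> n u /eqP; rewrite /= oppr_eq0 => /eqP /ir_exact[v vE].
  by exists (- v); rewrite linearN opprK.
Defined.

End Shift.

Section Connecting.
Variables (R : comNzRingType) (m : {pred R}) (A B C : lmodType R).
Variables (i : {linear A -> B}) (p : {linear B -> C}).

(** The extension class of [i], [p] on chosen resolutions: the augmentation of
    [A] extends to [s] on [B], and the failure of [s] to be a cocycle is
    measured by the map [t] of degree 1 between the resolutions. *)
Record extension_cocycle (I : injective_resolution A)
    (K : injective_resolution C) := ExtensionCocycle {
  ec_s : {linear B -> I 0%N};
  ec_t : chain_map K (neg_shift I);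
  ec_s_aug : forall a, ec_s (i a) = ir_aug I a;
  ec_t_aug : forall b, ec_t 0%N (ir_aug K (p b)) = - cpx_d I 0%N (ec_s b) }.

Lemma ec_td I K (e : extension_cocycle I K) n z :
  ec_t e n.+1 (cpx_d K n z) = - cpx_d I n.+1 (ec_t e n z).
Proof. exact: cm_comm. Qed.

Lemma extension_cocycle_exists I K :
  short_exact i p -> inhabited (extension_cocycle I K).
Proof.
move=> [i_inj p_surj pi ip].
have [s sE] := @ir_injective _ _ I 0%N _ _ i (ir_aug I) i_inj.
pose Z : submodClosed (I 1%N) := kerm (cpx_d I 1%N).
pose ds : {linear B -> I 1%N} := \- (cpx_d I 0%N \o s).
have dsZ b : ds b \in Z by apply/eqP; rewrite /ds /= linearN cpx_dd oppr0.
have ds0 b : p b = 0 -> corestr dsZ b = 0.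
  by move=> /ip[a <-]; apply: val_inj; rewrite [RHS]smval0 /= sE ir_augd oppr0.
have [f fp] := factor_surjection p_surj ds0.
have [t tE] := comparison K (neg_shift_resolution I) f.
by constructor; exists s t => // b; rewrite [LHS]tE; exact: congr1 (fp b).
Qed.

Definition connecting n
    (delta : {linear local_cohomology m n C -> local_cohomology m n.+1 A}) :=
  exists e : extension_cocycle (injres A) (injres C),
    forall z c, represents z c -> represents (ec_t e n z : injres A n.+1) (delta c).

Lemma connecting_exists n : short_exact i p -> exists delta, @connecting n delta.
Proof.
move=> /extension_cocycle_exists => /(_ (injres A) (injres C)) [e].
have tz (z : injres C n) : tcocycle m z -> tcocycle m (ec_t e n z : injres A n.+1).
  move=> [zt dz]; split; first exact: torsion_linear.
  by apply: oppr_inj; rewrite -ec_td dz linear0 oppr0.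
have tb (z : injres C n) : tboundary m z -> tboundary m (ec_t e n z : injres A n.+1).
  case: n z {tz} => [z ->|n z [w wt <-]].
    by exists 0; rewrite ?rpred0 // !linear0.
  exists (- ec_t e n w); first by rewrite rpredN; exact: torsion_linear.
  by rewrite ec_td linearN.
have [delta dE] := induced_map tz tb.
by exists delta, e.
Qed.

(** The horseshoe: [t] glues resolutions of [A] and [C] into one of [B], in
    which the short exact sequence becomes a degreewise split one. *)
Section Horseshoe.
Variables (I : injective_resolution A) (K : injective_resolution C).
Variable e : extension_cocycle I K.
Hypothesis exact_ip : short_exact i p.

Definition horseshoe_d_fun n (u : I n * K n) : I n.+1 * K n.+1 :=
  (cpx_d I n u.1 + ec_t e n u.2, cpx_d K n u.2).
Fact horseshoe_d_linear n : linear (@horseshoe_d_fun n).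
Proof.
move=> a u v; rewrite /horseshoe_d_fun /= !linearP.
by congr pair; rewrite /= scalerDr addrACA.
Qed.

Fact horseshoe_dd n (u : I n * K n) :
  horseshoe_d_fun (horseshoe_d_fun u) = 0.
Proof.
by rewrite /horseshoe_d_fun /= linearD !cpx_dd add0r ec_td subrr.
Qed.

Definition horseshoe_cpx : complex R :=
  @Complex R (fun n => (I n * K n)%type) (fun n => mk_linear (@horseshoe_d_linear n))
    horseshoe_dd.

Definition horseshoe_aug_fun (b : B) : I 0%N * K 0%N := (ec_s e b, ir_aug K (p b)).
Fact horseshoe_aug_linear : linear horseshoe_aug_fun.
Proof. by move=> a b c; rewrite /horseshoe_aug_fun !linearP. Qed.

Definition horseshoe : injective_resolution B.
Proof.
unshelve eexists horseshoe_cpx (mk_linear horseshoe_aug_linear).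
- move=> n X Y j f j_inj.
  have [g gE] := @ir_injective _ _ I n _ _ j (fst \o f) j_inj.
  have [h hE] := @ir_injective _ _ K n _ _ j (snd \o f) j_inj.
  have gh_linear : linear (fun y => (g y, h y) : I n * K n).
    by move=> a y z; rewrite !linearP.
  by exists (mk_linear gh_linear) => u /=; rewrite gE hE /=; case: (f u).
- have [_ _ _ ip] := exact_ip.
  move=> b b' [sb /ir_aug_inj pb].
  have /ip[a ab] : p (b - b') = 0 by rewrite linearB pb subrr.
  have a0 : a = 0.
    apply: (ir_aug_inj (i := I)); rewrite linear0 -(ec_s_aug e) ab.
    by rewrite linearB sb subrr.
  by apply/eqP; rewrite -subr_eq0 -ab a0 linear0.
- have [_ p_surj pi _] := exact_ip.
  move=> [a c] [da dc]; have [c' c'E] := ir_exact0 dc.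
  have [b bE] := p_surj c'.
  have [|a' a'E] := @ir_exact0 _ _ I (a - ec_s e b).
    rewrite linearB -(ec_t_aug e) bE c'E; exact: da.
  exists (i a' + b); rewrite linearD /= /horseshoe_aug_fun pi bE c'E ec_s_aug a'E.
  by rewrite linear0 -[LHS]/(_, _) /= subrK add0r.
- move=> b; rewrite /= /horseshoe_d_fun /= ir_augd ec_t_aug subrr; reflexivity.
- move=> n [a c] [da dc]; have [c' c'E] := ir_exact dc.
  have [|a' a'E] := @ir_exact _ _ I n (a - ec_t e n c').
    by rewrite linearB -ec_td c'E; exact: da.
  by exists (a', c'); rewrite /= /horseshoe_d_fun /= a'E c'E subrK.
Defined.

Fact horseshoe_inl_linear n : linear (fun a : I n => (a, 0) : (I n * K n)%type).
Proof. by move=> a u v; rewrite -[RHS]/(_, _) /= scaler0 addr0. Qed.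
Definition horseshoe_inl_lin n : {linear I n -> (I n * K n)%type} :=
  mk_linear (@horseshoe_inl_linear n).
Fact horseshoe_inl_comm n (u : I n) :
  horseshoe_inl_lin n.+1 (cpx_d I n u) = cpx_d horseshoe n (horseshoe_inl_lin n u).
Proof. by rewrite /= /horseshoe_d_fun /= !linear0 addr0. Qed.
Definition horseshoe_inl : chain_map I horseshoe :=
  @ChainMap R I horseshoe horseshoe_inl_lin horseshoe_inl_comm.

Fact horseshoe_snd_comm n (u : horseshoe n) :
  (cpx_d horseshoe n u).2 = cpx_d K n u.2.
Proof. by []. Qed.
Definition horseshoe_snd : chain_map horseshoe K :=
  @ChainMap R horseshoe K (fun n => snd : {linear (I n * K n)%type -> K n})
    horseshoe_snd_comm.

Lemma lifts_horseshoe_inl : lifts i horseshoe_inl.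
Proof.
move=> a; rewrite /= /horseshoe_aug_fun ec_s_aug.
by have [_ _ -> _] := exact_ip; rewrite linear0.
Qed.

Lemma lifts_horseshoe_snd : lifts p horseshoe_snd.
Proof. by []. Qed.

Lemma horseshoe_torsion n (a : I n) (c : K n) :
  a \in @torsion _ m _ -> c \in @torsion _ m _ ->
  ((a, c) : horseshoe n) \in @torsion _ m _.
Proof.
move=> /torsionP[k ak] /torsionP[l cl]; apply/torsionP; exists (maxn k l) => r rm.
rewrite -[LHS]/(_, _) /= ak ?cl //.
  exact: ideal_exp_le (leq_maxr k l) _ rm.
exact: ideal_exp_le (leq_maxl k l) _ rm.
Qed.

End Horseshoe.

Section LongExactSequence.
Hypothesis exact_ip : short_exact i p.
Variables (n : nat)
  (delta : {linear local_cohomology m n C -> local_cohomology m n.+1 A}).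
Hypothesis delta_ip : connecting delta.

Lemma lifts_id_exists (M : lmodType R) (I J : injective_resolution M) :
  exists th : chain_map I J, lifts (idfun : {linear M -> M}) th.
Proof. exact: comparison. Qed.

(** The horseshoe splits degreewise, so exactness can be read off its
    differential [(a, c) |-> (d a + t c, d c)]; lifts of the identity carry classes
    between it and the chosen resolution of [B]. *)
Lemma connecting_ker c :
  delta c = 0 -> exists b, local_cohomology_map m n p b = c.
Proof.
have [e eP] := delta_ip; have [z zc] := represents_ex c.
have [zt dz] := represents_cocycle zc; have tz := eP _ _ zc.
move=> c0; move: tz; rewrite c0 => /represents0[w wt wE].
pose L := horseshoe e exact_ip; pose u : L n := (- w, z).
have [th thE] := lifts_id_exists L (injres B).
have uc : tcocycle m u.
  split; first by apply: horseshoe_torsion => //; rewrite rpredN.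
  by rewrite /= /horseshoe_d_fun /= linearN wE dz addNr.
have [b bE] := cocycle_represents (tcocycle_map th uc).
exists b; apply/(representsB (represents_map (injres_map p) bE) zc).
apply: (@lifts_tboundary _ _ _ _ _ _ p (comp_cm (injres_map p) th)
          (horseshoe_snd e exact_ip) _ _ _ u) => //.
exact: lifts_comp thE (injres_mapP p) _.
Qed.

Lemma connecting_im a :
  local_cohomology_map m n.+1 i a = 0 -> exists c, delta c = a.
Proof.
have [e eP] := delta_ip; have [z za] := represents_ex a.
have zc := represents_cocycle za.
have iz := represents_map (injres_map i) za; move=> a0.
have {iz a0} iz0 : tboundary m (injres_map i n.+1 z).
  by apply/represents0; rewrite -a0.
pose L := horseshoe e exact_ip.
have [th thE] := lifts_id_exists (injres B) L.
have thz :
    tboundary m (th n.+1 (injres_map i n.+1 z) - horseshoe_inl e exact_ip n.+1 z).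
  apply: (@lifts_tboundary _ _ _ _ _ _ i (comp_cm th (injres_map i))
          (horseshoe_inl e exact_ip)) => //; last exact: (lifts_horseshoe_inl e exact_ip).
  exact: lifts_comp (injres_mapP i) thE _.
have [/(_ (tboundary_map th iz0))] := tboundary_eq thz.
case=> -[a' c'] tac' [da' dc'].
have [|c cE] := @cocycle_represents _ m _ n (c' : injres C n).
  split=> //.
  exact: (torsion_linear (snd : {linear (injres A n * injres C n)%type -> _}) tac').
exists c; apply/(representsB (eP _ _ cE) za).
exists (- a'); last by rewrite linearN -[X in _ - X]da' opprD addrCA subrr addr0.
rewrite rpredN.
exact: (torsion_linear (fst : {linear (injres A n * injres C n)%type -> _}) tac').
Qed.

Lemma map_connecting c : local_cohomology_map m n.+1 i (delta c) = 0.
Proof.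
have [e eP] := delta_ip; have [z zc] := represents_ex c.
have [zt dz] := represents_cocycle zc; have tz := eP _ _ zc.
pose L := horseshoe e exact_ip.
have [th thE] := lifts_id_exists L (injres B).
apply: (represents_uniq (represents_map (injres_map i) tz)).
apply/represents0.
have thz : tboundary m (th n.+1 (horseshoe_inl e exact_ip n.+1 (ec_t e n z))
    - injres_map i n.+1 (ec_t e n z)).
  apply: (@lifts_tboundary _ _ _ _ _ _ i (comp_cm th (horseshoe_inl e exact_ip))
          (injres_map i)) (represents_cocycle tz) => //.
    exact: lifts_comp (lifts_horseshoe_inl e exact_ip) thE _.
  exact: injres_mapP.
have [/(_ _) tz0 _] := tboundary_eq thz.
apply: tz0; apply: tboundary_map; exists (0, z).
  by apply: horseshoe_torsion => //; rewrite rpred0.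
by rewrite /= /horseshoe_d_fun /= linear0 add0r dz.
Qed.

Lemma connecting_map b : delta (local_cohomology_map m n p b) = 0.
Proof.
have [e eP] := delta_ip; have [z zb] := represents_ex b.
pose L := horseshoe e exact_ip.
have [th thE] := lifts_id_exists (injres B) L.
have thz := tcocycle_map th (represents_cocycle zb).
have [c cE] := cocycle_represents (tcocycle_map (horseshoe_snd e exact_ip) thz).
have -> : local_cohomology_map m n p b = c.
  apply/(representsB (represents_map (injres_map p) zb) cE).
  apply: (@lifts_tboundary _ _ _ _ _ _ p (injres_map p)
            (comp_cm (horseshoe_snd e exact_ip) th)) (represents_cocycle zb).
    exact: injres_mapP.
  exact: lifts_comp thE (lifts_horseshoe_snd e exact_ip) _.
apply: (represents_uniq (eP _ _ cE)); apply/represents0.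
move: thz => [tz dz]; exists (- (th n z).1).
  rewrite rpredN.
  exact: (torsion_linear (fst : {linear (injres A n * injres C n)%type -> _}) tz).
apply/eqP; rewrite linearN eq_sym -addr_eq0 addrC; apply/eqP.
by case: dz.
Qed.

End LongExactSequence.

Lemma local_cohomology_exact n b : short_exact i p ->
  local_cohomology_map m n p b = 0 -> exists a, local_cohomology_map m n i a = b.
Proof.
move=> exact_ip; have [z zb] := represents_ex b.
have zc := represents_cocycle zb.
have [e] := extension_cocycle_exists (injres A) (injres C) exact_ip.
pose L := horseshoe e exact_ip.
have [th thE] := lifts_id_exists (injres B) L.
have [th' th'E] := lifts_id_exists L (injres B).
move=> b0; have {b0} pz0 : tboundary m (injres_map p n z).
  by apply/represents0; rewrite -b0; exact: represents_map.
have thz : tboundary m ((th n z).2 - injres_map p n z).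
  apply: (@lifts_tboundary _ _ _ _ _ _ p (comp_cm (horseshoe_snd e exact_ip) th)
          (injres_map p)) zc => //; last exact: injres_mapP.
  exact: lifts_comp thE (lifts_horseshoe_snd e exact_ip) _.
have [_ /(_ pz0) z20] := tboundary_eq thz.
have [a ac ab] : exists2 a, tcocycle m a &
    tboundary m (horseshoe_inl e exact_ip n a - th n z).
  have [] := tcocycle_map th zc; move: (th n z) z20 => [a c] /= + act [].
  have at_ := torsion_linear (fst : {linear (injres A n * injres C n)%type -> _}) act.
  case: (n) a c act at_ => [|k] a c act at_ /=.
    move=> -> da _; exists a; last by rewrite subrr.
    by split=> //; move: da; rewrite linear0 addr0.
  move=> [w wt <-] da _; exists (a - ec_t e k w).
    split; first by rewrite rpredB //; exact: torsion_linear.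
    by rewrite linearB -ec_td.
  exists (0, - w); first by apply: horseshoe_torsion; rewrite ?rpred0 ?rpredN.
  rewrite /= /horseshoe_d_fun /= linear0 add0r !linearN.
  by rewrite -[RHS]/(_, _) /= addrAC subrr add0r sub0r.
have [c cE] := cocycle_represents ac.
exists c; apply/(representsB (represents_map (injres_map i) cE) zb).
have t1 : tboundary m (th' n (horseshoe_inl e exact_ip n a) - injres_map i n a).
  apply: (@lifts_tboundary _ _ _ _ _ _ i (comp_cm th' (horseshoe_inl e exact_ip))
          (injres_map i)) ac => //; last exact: injres_mapP.
  exact: lifts_comp (lifts_horseshoe_inl e exact_ip) th'E _.
have t2 : tboundary m (th' n (th n z) - z).
  apply: (@lifts_tboundary _ _ _ _ _ _ (idfun : {linear B -> B}) (comp_cm th' th)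
          (id_cm _)) zc => //.
  exact: lifts_comp thE th'E _.
have := tboundaryD 1 (tboundaryD (-1) t1 (tboundary_map th' ab)) t2.
by rewrite scaleN1r scale1r opprB (linearB (th' n)) !addrA !subrK.
Qed.

Lemma local_cohomology0_inj a : short_exact i p ->
  local_cohomology_map m 0 i a = 0 -> a = 0.
Proof.
move=> exact_ip; have [z za] := represents_ex a.
have [zt dz] := represents_cocycle za.
move=> a0; have {a0} iz0 : injres_map i 0%N z = 0.
  have := represents_map (injres_map i) za.
  by rewrite [cohomology_map _ _ _]a0 => /represents0.
have [v vE] := ir_exact0 dz; have [i_inj _ _ _] := exact_ip.
apply: (represents_uniq za); apply/represents0.
move: iz0; rewrite -vE injres_mapP -(linear0 (ir_aug (injres B))) => /ir_aug_inj.
by rewrite -(linear0 i) => /i_inj ->; rewrite linear0.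
Qed.

End Connecting.

Section ConnectingNatural.
Variables (R : comNzRingType) (m : {pred R}).
Variables (A B C A' B' C' : lmodType R).
Variables (i : {linear A -> B}) (p : {linear B -> C}).
Variables (i' : {linear A' -> B'}) (p' : {linear B' -> C'}).
Variables (a : {linear A -> A'}) (b : {linear B -> B'}) (c : {linear C -> C'}).
Hypothesis exact_ip : short_exact i p.
Hypothesis bi : forall u, b (i u) = i' (a u).
Hypothesis cp : forall u, c (p u) = p' (b u).

Section Resolutions.
Variables (I : injective_resolution A) (K : injective_resolution C).
Variables (I' : injective_resolution A') (K' : injective_resolution C').
Variables (e : extension_cocycle i p I K) (e' : extension_cocycle i' p' I' K').
Variables (phi : chain_map I I') (psi : chain_map K K').
Hypothesis (phi_a : lifts a phi) (psi_c : lifts c psi).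

Fact shift_cm_comm n (u : I n.+1) :
  phi n.+2 (cpx_d (neg_shift I) n u) = cpx_d (neg_shift I') n (phi n.+1 u).
Proof. by rewrite /= linearN cm_comm. Qed.
Definition shift_cm : chain_map (neg_shift I) (neg_shift I') :=
  @ChainMap R (neg_shift I) (neg_shift I') (fun n => phi n.+1) shift_cm_comm.

Section Correction.
Variable sg : {linear K 0%N -> I' 0%N}.

Definition correction_fun n : {linear K n -> neg_shift I' n} :=
  match n return {linear K n -> neg_shift I' n} with
  | 0 => \- (cpx_d I' 0%N \o sg)
  | k.+1 => \0
  end.
Fact correction_comm n (u : K n) :
  correction_fun n.+1 (cpx_d K n u) = cpx_d (neg_shift I') n (correction_fun n u).
Proof.
by case: n u => [|n] u; rewrite /= ?linear0 ?oppr0 // linearN cpx_dd !oppr0.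
Qed.
Definition correction : chain_map K (neg_shift I') :=
  @ChainMap R K (neg_shift I') correction_fun correction_comm.

End Correction.

(** The two ways round the square of extension cocycles differ by a map that
    is null homotopic once corrected in degree 0, where the two extensions
    [phi \o s] and [s' \o b] of the augmentation need not coincide. *)
Lemma extension_cocycle_natural n (z : K n) : tcocycle m z ->
  tboundary m (phi n.+1 (ec_t e n z) - ec_t e' n (psi n z) : I' n.+1).
Proof.
have [_ p_surj _ ip] := exact_ip.
pose f : {linear B -> I' 0%N} := (phi 0%N \o ec_s e) \- (ec_s e' \o b).
have [u /ip[v <-]|sg sgE] := factor_surjection (f := f) p_surj.
  by rewrite /f /= ec_s_aug phi_a bi ec_s_aug subrr.
have [u u0|sg' sg'E] := injective_module_factor (@ir_injective _ _ I' 0%N)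
    (h := ir_aug K) (f := sg).
  suff -> : u = 0 by exact: linear0.
  by apply: (ir_aug_inj (i := K)); rewrite u0 linear0.
pose D := sub_cm (K := K) (J := neg_shift_resolution I')
  (comp_cm shift_cm (ec_t e)) (comp_cm (ec_t e') psi).
pose E := sub_cm (K := K) (J := neg_shift_resolution I') D (correction sg').
have [u|E0 En] := null_homotopy (D := E).
  have [w <-] := p_surj u.
  rewrite /= sg'E sgE /f /= psi_c cp !ec_t_aug !linearN !linearB !cm_comm /=.
  by rewrite !opprK addrACA addNr subrr addr0.
case: n z => [|n] z [zt dz].
  exists (- sg' z); first by rewrite rpredN; exact: torsion_linear.
  apply/eqP; rewrite linearN eq_sym -subr_eq0; exact/eqP/(E0 z dz).
have [h hE] := En n; exists (- h z); first by rewrite rpredN; exact: torsion_linear.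
rewrite linearN; have := hE z dz; rewrite /= subr0 => ->; reflexivity.
Qed.

End Resolutions.

Lemma connecting_natural n
    (delta : {linear local_cohomology m n C -> local_cohomology m n.+1 A})
    (delta' : {linear local_cohomology m n C' -> local_cohomology m n.+1 A'}) u :
  connecting i p delta -> connecting i' p' delta' ->
  delta' (local_cohomology_map m n c u) = local_cohomology_map m n.+1 a (delta u).
Proof.
move=> [e eP] [e' e'P]; have [z zu] := represents_ex u.
apply/esym/(representsB (represents_map (injres_map a) (eP _ _ zu))
              (e'P _ _ (represents_map (injres_map c) zu))).
apply: extension_cocycle_natural (represents_cocycle zu); exact: injres_mapP.
Qed.

End ConnectingNatural.

(** * Multiplication by ring elements, and vanishing below the depth *)

Section Multiplication.
Variables (R : comNzRingType) (M : lmodType R).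

Fact scalm_linear (x : R) : linear (fun u : M => x *: u).
Proof. by move=> a u v; rewrite scalerDr !scalerA mulrC. Qed.
Definition scalm (x : R) : {linear M -> M} := mk_linear (scalm_linear x).

Definition quot1 (x : R) : lmodType R := quotmod (imgm (scalm x) : submodClosed M).
Definition pi1 (x : R) : {linear M -> quot1 x} := qpi (imgm (scalm x)).

Lemma pi1_eq0 x u : pi1 x u = 0 <-> exists v, u = x *: v.
Proof.
split=> [/eqP|[v ->]]; last by apply/eqP; rewrite qpi_eq0; apply/asboolP; exists v.
by rewrite qpi_eq0 => /asboolP[v <-]; exists v.
Qed.

Lemma pi1_surj x (q : quot1 x) : exists u, pi1 x u = q.
Proof. by have [u ->] := qpi_surj q; exists u. Qed.

Lemma short_exact_quot (S : submodClosed M) :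
  short_exact (@smval R M S : {linear submodule S -> M}) (qpi S).
Proof.
split; [exact: val_inj | by move=> q; have [u ->] := qpi_surj q; exists u | |].
  by move=> u; apply/eqP; rewrite qpi_eq0; exact: smP.
by move=> u /eqP; rewrite qpi_eq0 => uS; exists (Submodule uS).
Qed.

Lemma short_exact_scalm x : injective (scalm x) -> short_exact (scalm x) (pi1 x).
Proof.
split=> //; [exact: pi1_surj | by move=> u; apply/pi1_eq0; exists u |].
by move=> u /pi1_eq0[v ->]; exists v.
Qed.

End Multiplication.
Arguments scalm {R} M x.
Arguments quot1 {R} M x.
Arguments pi1 {R} M x.

Section Vanishing.
Variables (R : comNzRingType) (m : {pred R}).
Implicit Types M N A B C : lmodType R.

Definition lc_zero n M := forall c : local_cohomology m n M, c = 0.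

Lemma local_cohomology_scalm n M x (c : local_cohomology m n M) :
  local_cohomology_map m n (scalm M x) c = x *: c.
Proof.
rewrite (@local_cohomology_map_scale _ m n M M x (idfun : {linear M -> M})) //.
by rewrite local_cohomology_map_id.
Qed.

Lemma lc_zero_trivial n M : (forall u : M, u = 0) -> lc_zero n M.
Proof.
move=> M0 c; rewrite -[c](local_cohomology_map_id (f := scalm M 0)) => [|u].
  by rewrite local_cohomology_scalm scale0r.
by rewrite [u]M0 linear0.
Qed.

Lemma lc_zero_mid n A B C (i : {linear A -> B}) (p : {linear B -> C}) :
  short_exact i p -> lc_zero n A -> lc_zero n C -> lc_zero n B.
Proof.
move=> exact_ip A0 C0 b.
have [a <-] := local_cohomology_exact exact_ip (C0 (local_cohomology_map m n p b)).
by rewrite (A0 a) linear0.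
Qed.

Lemma lc_zero_right n A B C (i : {linear A -> B}) (p : {linear B -> C}) :
  short_exact i p -> lc_zero n B -> lc_zero n.+1 A -> lc_zero n C.
Proof.
move=> exact_ip B0 A0 c; have [delta dE] := connecting_exists m n exact_ip.
by have [b <-] := connecting_ker exact_ip dE (A0 (delta c)); rewrite (B0 b) linear0.
Qed.

Lemma lc_zero_left n A B C (i : {linear A -> B}) (p : {linear B -> C}) :
  short_exact i p -> lc_zero n C -> lc_zero n.+1 B -> lc_zero n.+1 A.
Proof.
move=> exact_ip C0 B0 a; have [delta dE] := connecting_exists m n exact_ip.
have [c <-] := connecting_im exact_ip dE (B0 (local_cohomology_map m n.+1 i a)).
by rewrite (C0 c) linear0.
Qed.

Lemma pow_ideal_exp x k : x \in m -> x ^+ k \in ideal_exp m k.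
Proof.
move=> xm; elim: k => // k IH; apply: mem_spanm.
by exists x, (x ^+ k); rewrite exprS.
Qed.

Lemma local_cohomology_torsion n M x (c : local_cohomology m n M) :
  x \in m -> exists k, x ^+ k *: c = 0.
Proof.
move=> xm; have [z zc] := represents_ex c.
have [/torsionP[k kz] _] := represents_cocycle zc; exists k.
have zk := represents_map (scale_cm (x ^+ k) (id_cm (injres M))) zc.
rewrite -(local_cohomology_scalm (x ^+ k)).
apply: (@local_cohomology_map_eq _ _ _ _ _ _
          (scale_cm (x ^+ k) (id_cm (injres M))) _ _ z) => //.
  by move=> u; rewrite [RHS]linearZ.
rewrite /= kz ?pow_ideal_exp //.
by apply/represents0; case: (n) => //= j; exists 0; rewrite ?rpred0 ?linear0.
Qed.

(** An element of [m] cannot act injectively on a nonzero local cohomology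
    module, whose elements are killed by its powers. *)
Lemma lc_zero_inj n M x : x \in m ->
  (forall c : local_cohomology m n M, x *: c = 0 -> c = 0) -> lc_zero n M.
Proof.
move=> xm xinj c; have [k] := local_cohomology_torsion c xm.
by elim: k => [|k IH]; rewrite ?scale1r // exprS -scalerA => /xinj.
Qed.

Lemma lc_zero_quot1 n M x : x \in m -> injective (scalm M x) ->
  (forall k, n = k.+1 -> lc_zero k (quot1 M x)) -> lc_zero n M.
Proof.
move=> xm /short_exact_scalm exact_x quot0; apply: (lc_zero_inj xm) => c.
rewrite -local_cohomology_scalm; case: n quot0 c => [|n] quot0 c.
  exact: (local_cohomology0_inj exact_x).
have [delta dE] := connecting_exists m n exact_x.
move=> xc0; have [c' <-] := connecting_im exact_x dE xc0.
by rewrite (quot0 n erefl c') linear0.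
Qed.

(** Regularity with each quotient formed one element at a time, the form in
    which inductions on the sequence use it. *)
Fixpoint weakly_regular (xs : seq R) M : Prop :=
  if xs is x :: xs' then
    injective (scalm M x) /\ weakly_regular xs' (quot1 M x)
  else True.

Lemma lc_zero_weakly_regular xs M n : {subset xs <= m} ->
  weakly_regular xs M -> (n < size xs)%N -> lc_zero n M.
Proof.
elim: xs M n => // x xs IH M n xsm [x_inj xs_reg] n_lt.
apply: (@lc_zero_quot1 _ _ x) => // [|k nk]; first by rewrite xsm ?mem_head.
apply: IH => // [y yxs|]; first by rewrite xsm // inE yxs orbT.
by rewrite nk in n_lt.
Qed.

Lemma lc_zero_quot1_lt d M x : injective (scalm M x) ->
  (forall n, (n < d.+1)%N -> lc_zero n M) ->
  forall n, (n < d)%N -> lc_zero n (quot1 M x).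
Proof.
move=> /short_exact_scalm exact_x M0 n nd.
by apply: (lc_zero_right exact_x); apply: M0; rewrite // ltnW.
Qed.

(** With [r] a retraction of the augmentation, the map [D] below vanishes on
    the augmentation, hence is null homotopic, and is the identity in positive
    degrees. *)
Lemma lc_zero_injective n (E : lmodType R) : injective_module E -> lc_zero n.+1 E.
Proof.
move=> E_inj c; pose I := injres E.
have [r rE] := E_inj _ _ (ir_aug I) (idfun : {linear E -> E}) (@ir_aug_inj _ _ I).
pose D_fun k : {linear I k -> I k} :=
  match k with 0 => idfun \- (ir_aug I \o r) | _.+1 => idfun end.
have D_comm k u : D_fun k.+1 (cpx_d I k u) = cpx_d I k (D_fun k u).
  by case: k u => [|k] u //=; rewrite linearB ir_augd subr0.
have [u|_ Dn] := null_homotopy (D := @ChainMap R I I D_fun D_comm).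
  by rewrite /= rE subrr.
have [z zc] := represents_ex c; have [zt dz] := represents_cocycle zc.
have [h hE] := Dn n; apply: (represents_uniq zc); apply/represents0.
by exists (h z); [exact: torsion_linear | rewrite -hE].
Qed.

End Vanishing.

(** * Noetherian rings and ideals *)

Definition submod_of (R : comNzRingType) (M : lmodType R) (P : {pred M})
    (P_closed : GRing.submod_closed P) : submodClosed M :=
  HB.pack P (GRing.isSubmodClosed.Build R M P (GRing.submod_closed_semi P_closed)).

Section Noetherian.
Variables (R : comNzRingType).
Implicit Types (I J : {pred R}) (x y r s : R).

(** Unlike [idealr_closed], this allows the unit ideal. *)
Definition is_ideal J : Prop := @GRing.submod_closed R R^o J.

Section IsIdeal.
Variable J : {pred R}.
Hypothesis J_ideal : is_ideal J.

Lemma is_ideal0 : 0 \in J. Proof. by case: J_ideal. Qed.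
Lemma is_idealP a u v : u \in J -> v \in J -> a * u + v \in J.
Proof. by case: J_ideal => _; apply. Qed.
Lemma is_idealM a u : u \in J -> a * u \in J.
Proof. by move=> uJ; rewrite -[_ * _]addr0 is_idealP // is_ideal0. Qed.
Lemma is_idealD u v : u \in J -> v \in J -> u + v \in J.
Proof. by move=> uJ vJ; rewrite -[u]mul1r is_idealP. Qed.

Lemma span_is_ideal (A : set R) :
  (forall u, A u -> u \in J) -> {subset @spanm R R^o A <= J}.
Proof. exact: (@spanm_sub R R^o A (submod_of J_ideal)). Qed.

Lemma is_ideal_proper : 1 \notin J -> idealr_closed J.
Proof. by split; [exact: is_ideal0 | | move=> a u v; exact: is_idealP]. Qed.

End IsIdeal.

Lemma idealr_is_ideal J : idealr_closed J -> is_ideal J.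
Proof. by case=> J0 _ JP; split. Qed.

Lemma span_ideal (A : set R) : is_ideal (@spanm R R^o A).
Proof. exact: spanm_closed. Qed.

Definition principal_sum J x : {pred R} := fun r => `[< exists a, r - a * x \in J >].

Section PrincipalSum.
Variables (J : {pred R}) (x : R).
Hypothesis J_ideal : is_ideal J.

Lemma principal_sum_ideal : is_ideal (principal_sum J x).
Proof.
split=> [|a u v /asboolP[b ub] /asboolP[c vc]]; apply/asboolP.
  by exists 0; rewrite mul0r subr0 is_ideal0.
exists (a * b + c); have := is_idealP J_ideal a ub vc.
by rewrite mulrBr mulrDl opprD addrACA mulrA.
Qed.

Lemma principal_sum_sub : {subset J <= principal_sum J x}.
Proof. by move=> r rJ; apply/asboolP; exists 0; rewrite mul0r subr0. Qed.

Lemma principal_sum_mem : x \in principal_sum J x.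
Proof. by apply/asboolP; exists 1; rewrite mul1r subrr is_ideal0. Qed.

End PrincipalSum.

Definition colon J x : {pred R} := fun r => r * x \in J.

Lemma colon_ideal J x : is_ideal J -> is_ideal (colon J x).
Proof.
move=> J_ideal; split=> [|a u v]; rewrite !unfold_in /colon.
  by rewrite mul0r; exact: is_ideal0.
by rewrite mulrDl -mulrA; exact: is_idealP.
Qed.

Hypothesis R_noetherian : noetherian_ring R.

Lemma ideal_finitely_generated J : is_ideal J ->
  exists s : seq R, J =i @spanm R R^o [set` s].
Proof.
move=> J_ideal; have [J1|J1] := boolP (1 \in J); last first.
  exact: R_noetherian (is_ideal_proper J_ideal J1).
exists [:: 1] => r; rewrite -[r]mulr1 is_idealM //; apply/esym.
apply: (is_idealM (span_ideal _)); apply: (@mem_spanm R R^o).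
by rewrite /= inE.
Qed.

Lemma maximal_ideal_exists (Q : {pred R} -> Prop) J0 :
  (forall J, Q J -> is_ideal J) -> Q J0 ->
  exists2 J, Q J & forall J', Q J' -> {subset J <= J'} -> {subset J' <= J}.
Proof.
move=> Q_ideal QJ0; apply: contrapT => no_max.
have step (J : {J | Q J}) : exists J' : {J | Q J},
    {subset sval J <= sval J'} /\ ~ {subset sval J' <= sval J}.
  case: J => J QJ; apply: contrapT => no; apply: no_max; exists J => // J' QJ' JJ'.
  by apply: contrapT => J'J; apply: no; exists (exist _ J' QJ').
pose F := fix F n : {J | Q J} :=
  if n is k.+1 then projT1 (cid (step (F k))) else exist _ J0 QJ0.
have FS n : {subset sval (F n) <= sval (F n.+1)} /\
    ~ {subset sval (F n.+1) <= sval (F n)} by exact: projT2 (cid (step (F n))).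
have F_ideal n : is_ideal (sval (F n)) by apply: Q_ideal; exact: proj2_sig (F n).
have Fle k l : (k <= l)%N -> {subset sval (F k) <= sval (F l)}.
  move=> /subnK <-; elim: (l - k)%N => // n IH r /IH.
  by have [+ _] := FS (n + k)%N; exact.
pose U : {pred R} := fun r => `[< exists n, r \in sval (F n) >].
have U_ideal : is_ideal U.
  split=> [|a u v /asboolP[k uk] /asboolP[l vl]]; apply/asboolP.
    by exists 0%N; exact: is_ideal0.
  exists (maxn k l); apply: (is_idealP (F_ideal _)).
    by apply: Fle uk; exact: leq_maxl.
  by apply: Fle vl; exact: leq_maxr.
have [s sE] := ideal_finitely_generated U_ideal.
have [n sn] : exists n, {subset s <= sval (F n)}.
  have : {subset s <= U} by move=> r rs; rewrite sE; apply: (@mem_spanm R R^o).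
  elim: (s) => [|r t IH] tU; first by exists 0%N.
  have [|k tk] := IH; first by move=> u ut; rewrite tU // inE ut orbT.
  have /asboolP[l rl] : r \in U by rewrite tU // mem_head.
  exists (maxn k l) => u; rewrite inE => /orP[/eqP ->|/tk].
    by apply: Fle rl; exact: leq_maxr.
  by apply: Fle; exact: leq_maxl.
have [_] := FS n; apply => r rF.
have : r \in U by apply/asboolP; exists n.+1.
by rewrite sE; apply: span_is_ideal => // u; exact: sn.
Qed.

Lemma noetherian_induction (P : {pred R} -> Prop) :
  (forall J, is_ideal J ->
     (forall J', is_ideal J' -> {subset J <= J'} -> ~ {subset J' <= J} -> P J') ->
     P J) ->
  forall J, is_ideal J -> P J.
Proof.
move=> IH J J_ideal; apply: contrapT => nPJ.
have [K|//|K [K_ideal nPK] Kmax] :=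
    @maximal_ideal_exists (fun J => is_ideal J /\ ~ P J) J; first by case.
apply: nPK; apply: IH => // J' J'_ideal KJ' J'K; apply: contrapT => nPJ'.
exact: J'K (Kmax _ (conj J'_ideal nPJ') KJ').
Qed.

(** Multiplicative form of the existence of primes: an ideal maximal among
    those that avoid all [s * x ^+ k] with [s] outside the prime [p] is prime,
    is contained in [p] and does not contain [x]. *)
Lemma prime_avoiding J (p : {pred R}) x :
  is_ideal J -> prime_ideal p ->
  (forall s k, s * x ^+ k \in J -> s \in p) ->
  exists q, [/\ prime_ideal q, {subset J <= q}, {subset q <= p} & x \notin q].
Proof.
move=> J_ideal [[p0 p1 pP] p_prime] Jx.
pose Q K := [/\ is_ideal K, {subset J <= K} &
  forall s k, s * x ^+ k \in K -> s \in p].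
have QJ : Q J by split.
have [K|q [q_ideal Jq qx] qmax] := maximal_ideal_exists _ QJ; first by case.
have qp : {subset q <= p} by move=> r rq; apply: (qx r 0%N); rewrite mulr1.
exists q; split=> //; last first.
  by apply: contra p1 => xq; apply: (qx 1 1%N); rewrite mul1r.
split; first by apply: is_ideal_proper => //; apply: contra p1; exact: qp.
have big u : u \notin q -> exists s k a, s \notin p /\ s * x ^+ k - a * u \in q.
  move=> uq; apply: contrapT => no.
  have uq' : u \in q; last by rewrite uq' in uq.
  apply: (qmax (principal_sum q u)); last exact: principal_sum_mem.
    split; first exact: principal_sum_ideal.
      by move=> r /Jq; exact: principal_sum_sub.
    move=> s k /asboolP[a sa]; apply: contrapT => /negP sp.
    by apply: no; exists s, k, a.
  exact: principal_sum_sub.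
move=> u v uv; apply: contrapT => /negP; rewrite negb_or => /andP[uq vq].
have [s [k [a [sp sa]]]] := big u uq; have [t [l [b [tp tb]]]] := big v vq.
suff /qx /p_prime /orP[] : s * t * x ^+ (k + l) \in q by exact/negP.
have -> : s * t * x ^+ (k + l) = t * x ^+ l * (s * x ^+ k - a * u) +
    (a * u * (t * x ^+ l - b * v) + a * b * (u * v)).
  by rewrite exprD; ring.
by do !apply: (is_idealD q_ideal); exact: (is_idealM q_ideal).
Qed.

End Noetherian.

(** * Injective modules over Noetherian rings *)

Section Baer.
Variable R : comNzRingType.

(** Partial linear maps from [B] to [E], as graphs. *)
Definition linear_graph (B E : lmodType R) (G : set (B * E)) : Prop :=
  [/\ G 0, forall (a : R) p q, G p -> G q -> G (a *: p + q) &
      forall v, G (0, v) -> v = 0].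

Lemma linear_graph_uniq (B E : lmodType R) (G : set (B * E)) b v w :
  linear_graph G -> G (b, v) -> G (b, w) -> v = w.
Proof.
move=> [_ GP G0] Gv Gw; apply/eqP; rewrite -subr_eq0; apply/eqP/G0.
have := GP (-1) _ _ Gw Gv.
by rewrite scaleN1r -[- _ + _]/(_, _) /= addNr addrC.
Qed.

Lemma injective_extends_graph (B E : lmodType R) (G : set (B * E)) :
  injective_module E -> linear_graph G ->
  exists g : {linear B -> E}, forall b v, G (b, v) -> g b = v.
Proof.
move=> E_inj [G0 GP Gfun].
have G_closed : GRing.submod_closed (fun p : (B * E)%type => `[< G p >]).
  split=> [|a u v /asboolP Gu /asboolP Gv]; apply/asboolP => //; exact: GP.
pose S : submodClosed (B * E)%type := submod_of G_closed.
pose i : {linear submodule S -> B} := fst \o @smval R _ S.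
pose f : {linear submodule S -> E} := snd \o @smval R _ S.
have [|g gE] := E_inj _ _ i f.
  move=> u v uv; apply/eqP; rewrite -subr_eq0; apply/eqP/val_inj.
  have uv0 : (smval (u - v)).1 = 0 by rewrite -[LHS]/(i (u - v)) linearB uv subrr.
  rewrite [RHS]smval0 -[LHS]/(smval (u - v)).
  have /asboolP : smval (u - v) \in S by exact: smP.
  by move: (smval (u - v)) uv0 => [b w] /= -> /Gfun ->.
exists g => b v Gbv; have bvS : (b, v) \in S by exact/asboolP.
by have := gE (Submodule bvS).
Qed.

(** Baer's criterion: extending one element at a time is enough, and the
    obstruction to adding [b] is a partial linear map on the ideal of the
    [r] with [r *: b] in the domain already reached. *)
Lemma baer (E : lmodType R) :
  (forall G : set (R^o * E), linear_graph G ->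
     exists e, forall r v, G (r, v) -> v = r *: e) ->
  injective_module E.
Proof.
move=> E_baer A B i f i_inj.
pose G0 : set (B * E) := fun p => exists a, p = (i a, f a).
have G00 : G0 0 by exists 0; rewrite !linear0.
(* The union of the empty chain is empty: hence the guard in the last clause. *)
pose P (G : set (B * E)) :=
  [/\ forall (a : R) p q, G p -> G q -> G (a *: p + q),
      forall v, G (0, v) -> v = 0 & (exists p, G p) -> forall p, G0 p -> G p].
have [F FP Ftot|G [[GP Gfun GG0] Gmax]] := @Zorn_bigcup _ P.
  split.
  - move=> a p q [X FX Xp] [Y FY Yq].
    have [XY|YX] := Ftot _ _ FX FY.
      by exists Y => //; have [+ _ _] := FP _ FY; apply => //; exact: XY.
    by exists X => //; have [+ _ _] := FP _ FX; apply => //; exact: YX.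
  - by move=> v [X FX Xv]; have [_ + _] := FP _ FX; apply.
  - move=> [p [X FX Xp]] q G0q; exists X => //.
    by have [_ _ +] := FP _ FX; apply => //; exists p.
have {}GG0 p : G0 p -> G p.
  move=> G0p; apply: (GG0 _ p G0p); apply: contrapT => Gempty; apply: (Gmax G0).
    split=> [q Gq|sub]; first by case: Gempty; exists q.
    by apply: Gempty; exists p; exact: sub.
  split=> // [a _ _ [u ->] [v ->]|v [a [ia ->]]].
    by exists (a *: u + v); rewrite !linearP.
  suff -> : a = 0 by rewrite linear0.
  by apply: i_inj; rewrite linear0.
have Ggraph : linear_graph G by split=> //; exact: GG0.
have Gtot b : exists v, G (b, v).
  pose Gb : set (R^o * E) := fun p => G (p.1 *: b, p.2).
  have [|e eE] := E_baer Gb.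
    split.
    - by rewrite /Gb /= scale0r; exact: GG0.
    - move=> a p q Gp Gq; have := GP a _ _ Gp Gq.
      by rewrite /Gb /= scalerDl -scalerA.
    - by move=> v; rewrite /Gb /= scale0r; exact: Gfun.
  exists e; apply: contrapT => nG.
  apply: (Gmax [set p | exists q (r : R), G q /\ p = q + r *: (b, e)]%classic).
    split=> [p Gp|sub]; first by exists p, 0; rewrite scale0r addr0.
    apply/nG/sub; exists 0, 1; rewrite scale1r add0r; split=> //; exact: GG0.
  split.
  - move=> a _ _ [p [r [Gp ->]]] [q [s [Gq ->]]].
    exists (a *: p + q), (a * r + s); split; first exact: GP.
    by rewrite scalerDr addrACA scalerA -scalerDl.
  - move=> v [[c w] [r [Gcw]]] [cr ->].
    have Gr : Gb (- r, w).
      rewrite /Gb /= scaleNr; suff <- : c = - (r *: b) by [].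
      by apply/eqP; rewrite -addr_eq0 -cr.
    by rewrite (eE _ _ Gr) scaleNr addNr.
  - by move=> _ p G0p; exists p, 0; rewrite scale0r addr0; split=> //; exact: GG0.
pose g b := projT1 (cid (Gtot b)).
have gE b : G (b, g b) by exact: projT2 (cid (Gtot b)).
have g_linear : linear g.
  move=> a u v; apply: (linear_graph_uniq Ggraph (gE _)).
  exact: (GP a _ _ (gE u) (gE v)).
exists (mk_linear g_linear) => u /=; apply: (linear_graph_uniq Ggraph (gE _)).
by apply: GG0; exists u.
Qed.

End Baer.

Section PowerTorsion.
Variables (R : comNzRingType) (y : R) (E : lmodType R).

Definition power_torsion : {pred E} := fun u => `[< exists k, y ^+ k *: u = 0 >].

Lemma power_torsion_le k l (u : E) :
  (k <= l)%N -> y ^+ k *: u = 0 -> y ^+ l *: u = 0.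
Proof. by move=> /subnK <- ku; rewrite exprD -scalerA ku scaler0. Qed.

Fact power_torsion_closed : GRing.submod_closed power_torsion.
Proof.
split=> [|a u v /asboolP[k ku] /asboolP[l lv]]; apply/asboolP.
  by exists 0%N; rewrite scaler0.
exists (maxn k l); rewrite scalerDr scalerA mulrC -scalerA.
rewrite (power_torsion_le (leq_maxl k l) ku) (power_torsion_le (leq_maxr k l) lv).
by rewrite scaler0 addr0.
Qed.
HB.instance Definition _ :=
  GRing.isSubmodClosed.Build R E power_torsion power_torsion_closed.

Hypotheses (R_noetherian : noetherian_ring R) (E_inj : injective_module E).

(** A map [f] from an ideal [J] to the [y]-torsion is killed by some [y ^+ c].
    As the colon ideals [J : y ^+ n] become stationary, [f] vanishes on [J]
    inside [y ^+ N R] for some [N] (Artin-Rees for a principal ideal), so it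
    extends by [0] to [J + y ^+ N R], and then to [R] with values killed by
    [y ^+ N]. *)
Lemma power_torsion_injective :
  injective_module (submodule (power_torsion : submodClosed E)).
Proof.
set T := submodule _; apply: baer => G G_graph; have [G0 GP Gfun] := G_graph.
pose J : {pred R} := fun r => `[< exists v : T, G (r, v) >].
have J_ideal : is_ideal J.
  split=> [|a u v /asboolP[b ub] /asboolP[c vc]]; apply/asboolP.
    by exists 0.
  by exists (a *: b + c); exact: (GP a _ _ ub vc).
(* [J] is finitely generated, so one power of [y] kills all values of [G]. *)
have [c cE] : exists c, forall r v, G (r, v) -> y ^+ c *: v = 0.
  have [s sE] := ideal_finitely_generated R_noetherian J_ideal.
  pose kill c : {pred R} := fun r => `[< exists2 v, G (r, v) & y ^+ c *: v = 0 >].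
  have kill_ideal c : is_ideal (kill c).
    split=> [|a u v /asboolP[b ub bc] /asboolP[d vd dc]]; apply/asboolP.
      by exists 0; rewrite ?scaler0.
    exists (a *: b + d); first exact: (GP a _ _ ub vd).
    by rewrite scalerDr dc addr0 scalerA mulrC -scalerA bc scaler0.
  have [c cE] : exists c, {subset s <= kill c}.
    have : {subset s <= J} by move=> r rs; rewrite sE; apply: (@mem_spanm R R^o).
    elim: (s) => [|r t IH] tJ; first by exists 0%N.
    have [|k tk] := IH; first by move=> u ut; rewrite tJ // inE ut orbT.
    have /asboolP[v rv] : r \in J by rewrite tJ // mem_head.
    have /asboolP[l lv] := smP v.
    have {}lv : y ^+ l *: v = 0 by apply: val_inj; rewrite [RHS]smval0 [LHS]linearZ.
    exists (maxn k l) => u; rewrite inE => /orP[/eqP ->|/tk /asboolP[w uw wk]].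
      apply/asboolP; exists v => //; move: lv.
      by rewrite -(subnK (leq_maxr k l)) exprD -scalerA => ->; rewrite scaler0.
    apply/asboolP; exists w => //; move: wk.
    by rewrite -(subnK (leq_maxl k l)) exprD -scalerA => ->; rewrite scaler0.
  exists c => r v Gv; have : r \in J by apply/asboolP; exists v.
  rewrite sE => /(span_is_ideal (kill_ideal c) cE) /asboolP[w Gw <-].
  by rewrite (linear_graph_uniq G_graph Gv Gw).
(* The ideals [J : y ^+ k] become stationary at [n]. *)
have [n nE] : exists n, forall k r, r * y ^+ k \in J -> r * y ^+ n \in J.
  pose Q I := is_ideal I /\ exists n, I =i colon J (y ^+ n).
  have QJ : Q (colon J (y ^+ 0)) by split; [exact: colon_ideal | exists 0%N].
  have [I []//|I [_ [n In]] Imax] := maximal_ideal_exists R_noetherian _ QJ.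
  exists n => k r rk; rewrite -[_ \in J]/(r \in colon J (y ^+ n)) -In.
  apply: (Imax (colon J (y ^+ (n + k)))).
  - by split; [exact: colon_ideal | exists (n + k)%N].
  - move=> u; rewrite In -[_ \in _]/(u * y ^+ n \in J) => un.
    rewrite -[_ \in _]/(u * y ^+ (n + k) \in J) exprD mulrA mulrC.
    exact: is_idealM.
  - rewrite -[_ \in _]/(r * y ^+ (n + k) \in J) exprD mulrCA.
    exact: is_idealM.
(* An element [s * y ^+ (c + n)] of [J] is [y ^+ c] times the element
   [s * y ^+ n] of [J], so its value is killed. *)
pose N := (c + n)%N.
pose G' : set (R^o * E) := fun p =>
  exists (j s : R) (v : T), [/\ G (j, v), p.1 = j + s * y ^+ N & p.2 = smval v].
have G'_graph : linear_graph G'.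
  split.
  - by exists 0, 0, 0; rewrite mul0r addr0 smval0.
  - move=> a [_ _] [_ _] [j [s [v [jv /= -> ->]]]] [k [t [w [kw /= -> ->]]]].
    exists (a * j + k), (a * s + t), (a *: v + w); split=> /=; first exact: (GP a _ _ jv kw).
      by rewrite -[a *: _]/(a * _); ring.
    by apply/esym; exact: smval_linear.
  - move=> _ [j [s [v [jv /= /esym/eqP js ->]]]].
    move: js; rewrite addr_eq0 => /eqP jE.
    have /nE : - s * y ^+ N \in J by rewrite mulNr -jE; apply/asboolP; exists v.
    move=> /asboolP[w sw].
    suff -> : v = 0 by rewrite smval0.
    have Gw : G (j, y ^+ c *: w + 0).
      have -> : j = y ^+ c * (- s * y ^+ n) + 0 by rewrite jE /N exprD; ring.
      exact: (GP (y ^+ c) _ _ sw G0).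
    by rewrite (linear_graph_uniq G_graph jv Gw) (cE _ _ sw) addr0.
have [g gE] := injective_extends_graph E_inj G'_graph.
have gZ r : g r = r *: g 1 by rewrite -linearZ /= -[_ *: 1]/(r * 1) mulr1.
have g1T : g 1 \in power_torsion.
  apply/asboolP; exists N; rewrite -gZ; apply: gE.
  by exists 0, 1, 0; rewrite mul1r add0r smval0.
exists (Submodule g1T) => r v Gv; apply: val_inj; rewrite [RHS]linearZ /= -gZ.
apply/esym/gE; exists r, 0, v; split=> //=; by rewrite mul0r addr0.
Qed.

End PowerTorsion.

(** * Vanishing above the dimension *)

Section TorsionModules.
Variables (R : comNzRingType) (m : {pred R}).
Hypothesis R_noetherian : noetherian_ring R.

Definition annihilator (N : lmodType R) (P : N -> Prop) : {pred R} :=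
  fun r => `[< forall u, P u -> r *: u = 0 >].

Lemma annihilator_ideal (N : lmodType R) (P : N -> Prop) :
  is_ideal (annihilator P).
Proof.
split=> [|a r s /asboolP rP /asboolP sP]; apply/asboolP => u Pu.
  exact: scale0r.
by rewrite scalerDl -scalerA rP // sP // scaler0 addr0.
Qed.

Lemma ideal_expS_sub (J : {pred R}) k : is_ideal J ->
  (forall a b, a \in m -> b \in ideal_exp m k -> a * b \in J) ->
  {subset ideal_exp m k.+1 <= J}.
Proof.
move=> J_ideal mJ; apply: (@spanm_sub R R^o _ (submod_of J_ideal)).
by move=> _ [a [b [am bm ->]]]; exact: mJ.
Qed.

Lemma torsion_generators_mul (ys : seq R) (N : lmodType R) (u : N) :
  {subset m <= @spanm R R^o [set` ys]} ->
  (forall y, y \in ys -> y *: u \in @torsion _ m _) -> u \in @torsion _ m _.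
Proof.
move=> m_ys uy.
have [k kE] : exists k, forall y, y \in ys ->
    forall b, b \in ideal_exp m k -> b *: (y *: u) = 0.
  elim: ys uy {m_ys} => [|y ys IH] uy; first by exists 0%N.
  have [|k kE] := IH; first by move=> z zys; rewrite uy // inE zys orbT.
  have /torsionP[l lE] := uy y (mem_head _ _).
  exists (maxn k l) => z; rewrite inE => /orP[/eqP ->|/kE zk] b bm.
    by apply: lE; exact: ideal_exp_le (leq_maxr k l) _ bm.
  by apply: zk; exact: ideal_exp_le (leq_maxl k l) _ bm.
apply/torsionP; exists k.+1 => r rm.
have u_ideal := annihilator_ideal (fun v => v = u).
suff /asboolP ru : r \in annihilator (fun v => v = u) by exact: ru.
refine (ideal_expS_sub u_ideal _ rm) => a b am bm; apply/asboolP => _ ->.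
have b_ideal := annihilator_ideal (fun v => v = b *: u).
have /asboolP : a \in annihilator (fun v => v = b *: u).
  apply: (span_is_ideal b_ideal _ (m_ys a am)) => y /= yys.
  by apply/asboolP => _ ->; rewrite scalerA mulrC -scalerA kE.
by rewrite -scalerA => ->.
Qed.

(** Multiplying by a generator lowers its exponent, so [torsion_generators_mul]
    applies by induction on the sum of the exponents. *)
Lemma torsion_of_generators (ys : seq R) (N : lmodType R) (u : N) :
  {subset m <= @spanm R R^o [set` ys]} ->
  (forall y, y \in ys -> exists k, y ^+ k *: u = 0) -> u \in @torsion _ m _.
Proof.
move=> m_ys uy.
have ex y : exists k, y \in ys -> y ^+ k *: u = 0.
  by have [/uy[k kE]|] := boolP (y \in ys); [exists k | exists 0%N].
have [k kE] : exists k : R -> nat, forall y, y \in ys -> y ^+ k y *: u = 0.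
  by exists (fun y => projT1 (cid (ex y))) => y; exact: (projT2 (cid (ex y))).
have [n] : exists n, (\sum_(y <- ys) k y < n)%N by exists (\sum_(y <- ys) k y).+1%N.
elim: n k u kE {uy ex} => // n IH k u kE kn.
apply: (torsion_generators_mul m_ys) => y yys.
have := kE y yys; case ky: (k y) => [|j]; rewrite ?expr0 ?scale1r.
  by move=> ->; rewrite scaler0 rpred0.
move=> yu; apply: (IH (fun z => if z == y then j else k z)).
  move=> z zys; case: eqP => [->|_]; first by rewrite scalerA -exprSr.
  by rewrite scalerA mulrC -scalerA kE // scaler0.
move: kn; rewrite ltnS; apply: leq_trans.
rewrite ![\sum_(_ <- ys) _]big_seq.
rewrite (perm_big _ (perm_to_rem yys)) [X in (_ < X)%N](perm_big _ (perm_to_rem yys)).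
rewrite !big_cons yys eqxx ky /= -addSn; apply: leq_add => //.
by apply: leq_sum => z _; case: eqP => // ->; rewrite ky.
Qed.

(** Iterating over generators of [m] the passage to elements killed by powers
    of one element, which preserves injectivity. *)
Lemma torsion_embedding (ys : seq R) (N : lmodType R) :
  (forall (u : N) y, y \in ys -> exists k, y ^+ k *: u = 0) ->
  exists (T : lmodType R) (i : {linear N -> T}),
    [/\ injective_module T, injective i &
        forall (u : T) y, y \in ys -> exists k, y ^+ k *: u = 0].
Proof.
elim: ys => [|y ys IH] uy.
  by have [E [i [E_inj i_inj]]] := enough_injectives N; exists E, i.
have [|T [i [T_inj i_inj Ty]]] := IH.
  by move=> u z zys; apply: uy; rewrite inE zys orbT.
pose S : submodClosed T := @power_torsion R y T.
have iS u : i u \in S.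
  have [k ku] := uy u y (mem_head _ _).
  by apply/asboolP; exists k; rewrite -linearZ ku linear0.
exists (submodule S), (corestr iS); split.
- exact: power_torsion_injective.
- by move=> u v [] /i_inj.
- move=> u z; rewrite inE => /orP[/eqP ->|zys].
    have /asboolP[k ku] := smP u; exists k.
    by apply: val_inj; rewrite [RHS]smval0 [LHS]linearZ.
  have [k ku] := Ty (smval u) z zys; exists k.
  by apply: val_inj; rewrite [RHS]smval0 [LHS]linearZ.
Qed.

Hypothesis m_ideal : is_ideal m.

(** The cokernel of an embedding into a torsion injective module is again
    torsion, so the long exact sequence lowers the degree.  In degree 1, an
    element of [H^0] of the cokernel comes from the injective module, all of
    whose elements are torsion. *)
Lemma lc_zero_torsion n (N : lmodType R) :
  (forall u : N, u \in @torsion _ m _) -> lc_zero m n.+1 N.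
Proof.
have [ys ysE] := ideal_finitely_generated R_noetherian m_ideal.
elim: n N => [|n IH] N N_torsion.
all: have [u y yys|T [i [T_inj i_inj T_pow]]] := @torsion_embedding ys N.
1,3: have /torsionP[k ku] := N_torsion u; exists k; apply/ku/pow_ideal_exp.
1,2: by rewrite ysE; apply: (@mem_spanm R R^o).
all: have T_torsion (u : T) : u \in @torsion _ m _
  by apply: (torsion_of_generators (ys := ys)) => [r|y yys];
     [rewrite ysE | exact: T_pow].
all: have exact_i : short_exact i (qpi (imgm i : submodClosed T))
  by split=> //; [move=> q; have [u ->] := qpi_surj q; exists u
     | move=> u; apply/eqP; rewrite qpi_eq0; apply/asboolP; exists u
     | move=> u /eqP; rewrite qpi_eq0 => /asboolP].
all: have T0 k := @lc_zero_injective _ m k T T_inj.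
- move=> a; have [delta dE] := connecting_exists m 0 exact_i.
  have [c <-] := connecting_im exact_i dE (T0 _ (local_cohomology_map m 1 i a)).
  have [z zc] := represents_ex c; have [zt dz] := represents_cocycle zc.
  have [_ p_surj _ _] := exact_i.
  have [q qz] := ir_exact0 dz; have [u uq] := p_surj q.
  have [|b bE] := @cocycle_represents _ m _ 0 (ir_aug (injres T) u).
    by split; [exact: torsion_linear | exact: ir_augd].
  suff <- : local_cohomology_map m 0 (qpi (imgm i : submodClosed T)) b = c.
    exact: (connecting_map exact_i dE).
  apply: (local_cohomology_map_eq (injres_mapP _) bE).
  by rewrite injres_mapP uq qz.
- apply: (lc_zero_left exact_i) => //; apply: IH => q.
  by have [u ->] := qpi_surj q; exact: torsion_linear.
Qed.

End TorsionModules.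

Section Grothendieck.
Variables (R : comNzRingType) (m : {pred R}).
Hypotheses (R_noetherian : noetherian_ring R) (m_ideal : is_ideal m).
Implicit Types M N : lmodType R.

Definition dim_lt M e := forall p l, prime_chain M p l -> (l < e)%N.

Lemma dim_lt_sub M N e :
  (forall r, (forall u : M, r *: u = 0) -> forall u : N, r *: u = 0) ->
  dim_lt M e -> dim_lt N e.
Proof.
move=> MN M_e p l [pN p_lt]; apply: (M_e p); split=> // k /pN[p_prime Np].
by split=> // r /MN /Np.
Qed.

(** Below any prime containing the annihilator of [M / x M] there is one that
    contains the annihilator of [M] and avoids the nonzerodivisor [x]. *)
Lemma dim_lt_quot1 M x e : injective (scalm M x) ->
  dim_lt M e.+1 -> dim_lt (quot1 M x) e.
Proof.
move=> x_inj M_e p l [pQ p_lt].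
have [p0_prime Qp0] := pQ 0%N isT.
have xp0 : x \in p 0%N.
  apply: Qp0 => q; have [u <-] := pi1_surj q.
  by rewrite -linearZ; apply/pi1_eq0; exists u.
have x_pow k (u : M) : x ^+ k *: u = 0 -> u = 0.
  elim: k => [|k IH]; first by rewrite scale1r.
  rewrite exprS -scalerA => xu; apply/IH/x_inj.
  by rewrite linear0.
have [s k|q [q_prime Mq qp0 xq]] := prime_avoiding R_noetherian (x := x)
    (annihilator_ideal (fun _ : M => True)) p0_prime.
  move=> /asboolP skM; apply: Qp0 => v; have [u <-] := pi1_surj v.
  rewrite -linearZ; have -> : s *: u = 0; last exact: linear0.
  by apply: (x_pow k); rewrite scalerA mulrC skM.
rewrite -ltnS; apply: (M_e (fun k => if k is k'.+1 then p k' else q)).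
split=> [[_|k kl]|[_|k kl]] //.
- by split=> // r rM; apply: Mq; apply/asboolP => u _.
- have [pk Qpk] := pQ k kl; split=> // r rM; apply: Qpk => v.
  by have [u <-] := pi1_surj v; rewrite -linearZ rM linear0.
- by split=> // /(_ _ xp0); exact/negP.
- exact: p_lt.
Qed.

Lemma dim_lt_gt0 M e (p : {pred R}) : prime_ideal p ->
  (forall r, (forall u : M, r *: u = 0) -> r \in p) -> dim_lt M e -> (0 < e)%N.
Proof. by move=> p_prime Mp M_e; apply: (M_e (fun _ => p)); split. Qed.

(** By Noetherian induction on the annihilator [J] of a cyclic module [N].  If
    [a * b] is in [J] but [a] and [b] are not, [N] is an extension of [N / a N]
    by [a N], which are cyclic with larger annihilators.  If [J] is prime,
    either it contains [m] and [N] is torsion, or some [r] in [m] is regular on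
    [N], and [N / r N] has a larger annihilator and a smaller dimension. *)
Lemma lc_zero_cyclic J : is_ideal J ->
  forall N (u : N) e n, (forall v, exists r, v = r *: u) ->
  (forall r, r *: u = 0 <-> r \in J) -> dim_lt N e -> (e <= n)%N -> lc_zero m n N.
Proof.
move: J; apply: (noetherian_induction R_noetherian).
move=> J J_ideal IH N u e n u_gen uJ N_e en.
have annJ r : r \in J <-> forall v : N, r *: v = 0.
  split=> [/uJ ru v|rN]; last exact/uJ.
  by have [s ->] := u_gen v; rewrite scalerA mulrC -scalerA ru scaler0.
have quot_gen a (v : quot1 N a) : exists r, v = r *: pi1 N a u.
  have [w <-] := pi1_surj v; have [r ->] := u_gen w.
  by exists r; rewrite linearZ.
have quot_ann a r : r *: pi1 N a u = 0 <-> r \in principal_sum J a.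
  rewrite -linearZ; apply: (iff_trans (pi1_eq0 _ _)).
  split=> [[v ruv]|/asboolP[b rab]].
    have [b vb] := u_gen v; apply/asboolP; exists b; apply/uJ.
    by rewrite scalerBl ruv vb scalerA [a * b]mulrC subrr.
  exists (b *: u); apply/eqP; rewrite scalerA [a * b]mulrC -subr_eq0 -scalerBl.
  exact/eqP/uJ.
have IHquot a k d : a \notin J -> dim_lt (quot1 N a) d -> (d <= k)%N ->
    lc_zero m k (quot1 N a).
  move=> aJ; apply: (IH (principal_sum J a) _ _ _ _ (pi1 N a u)) => //.
  - exact: principal_sum_ideal.
  - exact: principal_sum_sub.
  - by move=> /(_ a (principal_sum_mem _ J_ideal)); exact/negP.
  - exact: quot_gen.
have [J1|J1] := boolP (1 \in J).
  by apply: lc_zero_trivial => v; rewrite -[v]scale1r ((annJ 1).1 J1).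
have [J_prime|] := pselect (prime_idealr_closed J); last first.
  move=> nprime; have [a [b [ab aJ bJ]]] :
      exists a b, [/\ a * b \in J, a \notin J & b \notin J].
    apply: contrapT => no; apply: nprime => a b ab.
    by apply: contrapT => /negP; rewrite negb_or => /andP[aJ bJ]; apply: no; exists a, b.
  apply: (lc_zero_mid (short_exact_quot (imgm (scalm N a)))); last first.
    apply: (IHquot a n e) => //; apply: dim_lt_sub N_e => r rN v.
    by have [w <-] := pi1_surj v; rewrite -linearZ rN linear0.
  have auS : a *: u \in (imgm (scalm N a) : submodClosed N) by apply/asboolP; exists u.
  apply: (IH (colon J a) _ _ _ _ (Submodule auS) e) => //.
  - exact: colon_ideal.
  - by move=> r; rewrite -[_ \in colon _ _]/(r * a \in J) mulrC; exact: is_idealM.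
  - move=> /(_ b); rewrite -[_ \in colon _ _]/(b * a \in J) mulrC ab => /(_ isT).
    exact/negP.
  - move=> [v vS]; have /asboolP[w vw] := vS; have [r wr] := u_gen w.
    exists r; apply: val_inj; rewrite [RHS]linearZ /= -vw wr /=.
    by rewrite !scalerA mulrC.
  - move=> r; rewrite -[_ \in colon _ _]/(r * a \in J) -uJ -scalerA; split.
      by move=> /(congr1 (@smval _ _ _)); rewrite smval0 linearZ.
    by move=> rau; apply: val_inj; rewrite [RHS]smval0 [LHS]linearZ.
  - apply: dim_lt_sub N_e => r rN v.
    by apply: val_inj; rewrite [RHS]smval0 [LHS]linearZ; exact: rN.
have Jp : prime_ideal J by split=> //; exact: is_ideal_proper.
have := dim_lt_gt0 Jp (fun r rN => (annJ r).2 rN) N_e.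
case: e N_e en => // e N_e en _.
have [mJ|] := pselect {subset m <= J}.
  case: n en => // n _; apply: lc_zero_torsion => // v.
  apply/torsionP; exists 1%N => r rm; apply: ((annJ r).1 _ v); apply: mJ.
  by refine (ideal_expS_sub m_ideal _ rm) => a b am _; rewrite mulrC is_idealM.
move=> mJ; have [r rm rJ] : exists2 r, r \in m & r \notin J.
  apply: contrapT => no; apply: mJ => r rm; apply: contrapT => /negP rJ.
  by apply: no; exists r.
have r_inj : injective (scalm N r).
  move=> v w rvw; apply/eqP; rewrite -subr_eq0; have [a va] := u_gen (v - w).
  rewrite va; apply/eqP/uJ.
  have /uJ/J_prime : (r * a) *: u = 0.
    by rewrite -scalerA -va scalerBr; apply/eqP; rewrite subr_eq0; apply/eqP.
  by rewrite (negbTE rJ).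
apply: (lc_zero_quot1 rm r_inj) => k nk.
apply: (IHquot r k e) => //; first exact: dim_lt_quot1.
by rewrite nk in en.
Qed.

Lemma finitely_generated_quot M (S : submodClosed M) :
  finitely_generated M -> finitely_generated (quotmod S).
Proof.
move=> [s sE]; exists (map (qpi S) s) => q; have [u ->] := qpi_surj q.
have /asboolP[t [ts ->]] := sE u; rewrite linear_sum.
rewrite big_seq; apply: rpred_sum => p pt.
rewrite linearZ; apply/rpredZ/mem_spanm; apply: map_f; exact: ts.
Qed.

(** Grothendieck's vanishing theorem: a finitely generated module is an iterated
    extension of cyclic modules with annihilators containing its own. *)
Lemma lc_zero_dim M e n :
  finitely_generated M -> dim_lt M e -> (e <= n)%N -> lc_zero m n M.
Proof.
move=> [s]; move: {2}(size s) (erefl (size s)) => l.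
elim: l M s => [|l IH] M [|u s] //= sl s_gen M_e en.
  apply: lc_zero_trivial => u; have /asboolP[t [ts ->]] := s_gen u.
  rewrite big_seq big1 // => p /ts; by rewrite /= in_nil.
pose S : submodClosed M := spanm [set u]%classic.
have uS : u \in S by exact: mem_spanm.
apply: (lc_zero_mid (short_exact_quot S)).
  apply: (lc_zero_cyclic (annihilator_ideal (fun v => v = u)) (u := Submodule uS)) en.
  - move=> [v vS]; have /asboolP[t [tu vE]] := vS.
    exists (\sum_(p <- t) p.1); apply: val_inj; rewrite [RHS]linearZ /= vE.
    rewrite scaler_suml big_seq [RHS]big_seq; apply: eq_bigr => p /tu /= ->.
    by [].
  - move=> r; split=> [ru|/asboolP ru].
      by apply/asboolP => _ ->; move/(congr1 (@smval _ _ _)): ru; rewrite smval0 linearZ.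
    by apply: val_inj; rewrite [RHS]smval0 [LHS]linearZ; exact: ru.
  - apply: dim_lt_sub M_e => r rM v.
    by apply: val_inj; rewrite [RHS]smval0 [LHS]linearZ; exact: rM.
apply: (IH _ (map (qpi S) s)) en; first by rewrite size_map; case: sl.
  move=> q; have [v ->] := qpi_surj q; have /asboolP[t [ts ->]] := s_gen v.
  rewrite linear_sum big_seq; apply: rpred_sum => p /ts.
  rewrite /= inE linearZ => /orP[/eqP ->|ps]; apply: rpredZ.
    have -> : (qpi S : {linear M -> quotmod S}) u = 0 by apply/eqP; rewrite qpi_eq0.
    exact: rpred0.
  by apply: mem_spanm; exact: map_f.
apply: dim_lt_sub M_e => r rM v.
by have [w ->] := qpi_surj v; rewrite -linearZ rM linear0.
Qed.

End Grothendieck.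

(** * Regular sequences *)

Section RegularSequences.
Variable R : comNzRingType.
Implicit Types (M N : lmodType R) (xs : seq R).

Lemma ideal_smul_nil M u : u \in ideal_smul M [::] -> u = 0.
Proof.
move=> /asboolP[t [t_nil ->]]; rewrite big_seq big1 // => p /t_nil [x [v []]].
by rewrite in_nil.
Qed.

Lemma ideal_smul_mem M xs x u : x \in xs -> x *: u \in ideal_smul M xs.
Proof. by move=> xxs; apply: mem_spanm; exists x, u. Qed.

Lemma ideal_smul_linear M N xs (f : {linear M -> N}) u :
  u \in ideal_smul M xs -> f u \in ideal_smul N xs.
Proof.
move=> /asboolP[t [t_xs ->]]; rewrite linear_sum big_seq.
apply: rpred_sum => p /t_xs [x [v [xxs pv]]].
by rewrite linearZ pv linearZ; apply/rpredZ/ideal_smul_mem.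
Qed.

Lemma ideal_smul_lift M N xs (f : {linear M -> N}) v :
  (forall w, exists u, f u = w) -> v \in ideal_smul N xs ->
  exists2 u, u \in ideal_smul M xs & f u = v.
Proof.
move=> f_surj.
pose P : {pred N} := fun v => `[< exists2 u, u \in ideal_smul M xs & f u = v >].
have P_closed : GRing.submod_closed P.
  split=> [|a v1 v2 /asboolP[u1 u1I <-] /asboolP[u2 u2I <-]]; apply/asboolP.
    by exists 0; rewrite ?rpred0 ?linear0.
  by exists (a *: u1 + u2); rewrite ?linearP // rpredD // rpredZ.
move=> vI; suff /asboolP : v \in submod_of P_closed by [].
move: v vI; apply: spanm_sub => _ [x [w [xxs ->]]]; have [u <-] := f_surj w.
by apply/asboolP; exists (x *: u); [exact: ideal_smul_mem | exact: linearZ].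
Qed.

Lemma ideal_smul_cons M x xs u : u \in ideal_smul M (x :: xs) ->
  exists v w, w \in ideal_smul M xs /\ u = x *: v + w.
Proof.
pose P : {pred M} := fun u =>
  `[< exists v w, w \in ideal_smul M xs /\ u = x *: v + w >].
have P_closed : GRing.submod_closed P.
  split=> [|a _ _ /asboolP[v [w [wI ->]]] /asboolP[v' [w' [w'I ->]]]]; apply/asboolP.
    by exists 0, 0; rewrite rpred0 scaler0 addr0.
  exists (a *: v + v'), (a *: w + w'); split; first by rewrite rpredD // rpredZ.
  by rewrite !scalerDr addrACA !scalerA mulrC.
move=> uI; suff /asboolP : u \in submod_of P_closed by [].
move: u uI; apply: spanm_sub => _ [y [v [+ ->]]].
rewrite inE => /orP[/eqP ->|yxs]; apply/asboolP.
  by exists v, 0; rewrite rpred0 addr0.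
by exists 0, (y *: v); rewrite scaler0 add0r ideal_smul_mem.
Qed.

Lemma ideal_smul_pi1 M x xs u :
  (pi1 M x u \in ideal_smul (quot1 M x) xs) = (u \in ideal_smul M (x :: xs)).
Proof.
apply/idP/idP => [|/ideal_smul_cons[v [w [wI ->]]]].
  move=> /(ideal_smul_lift (@pi1_surj _ M x))[w wI /eqP].
  rewrite -subr_eq0 -linearB => /eqP /pi1_eq0[v wu].
  have -> : u = w + x *: - v by rewrite scalerN -wu opprB addrC subrK.
  rewrite rpredD //; last by apply: ideal_smul_mem; exact: mem_head.
  move: w wI {wu}; apply: spanm_sub => _ [y [z [yxs ->]]].
  by apply: ideal_smul_mem; rewrite inE yxs orbT.
have xv0 : pi1 M x (x *: v) = 0 by apply/pi1_eq0; exists v.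
by rewrite linearD xv0 add0r; exact: ideal_smul_linear.
Qed.

Lemma regular_weakly_regular M xs : regular_seq M xs -> weakly_regular xs M.
Proof.
case=> xs_inj _.
have {xs_inj} : forall j, (j < size xs)%N -> forall u,
    xs`_j *: u \in ideal_smul M (take j xs) -> u \in ideal_smul M (take j xs).
  move=> j /xs_inj inj u xu.
  have /inj /eqP : xs`_j *: qpi (ideal_smul M (take j xs) : submodClosed M) u =
      xs`_j *: 0.
    by rewrite scaler0 -linearZ; apply/eqP; rewrite qpi_eq0.
  by rewrite qpi_eq0.
elim: xs M => //= x xs IH M xs_inj; split.
  move=> u v xuv; apply/eqP; rewrite -subr_eq0; apply/eqP.
  apply: ideal_smul_nil; apply: (xs_inj 0%N) => //=.
  by rewrite scalerBr; move: xuv => /= ->; rewrite subrr rpred0.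
apply: IH => j j_lt q; have [u <-] := pi1_surj q.
rewrite -linearZ !ideal_smul_pi1; exact: (xs_inj j.+1).
Qed.

Lemma pi1_map_exists M N x y (f : {linear M -> N}) :
  (forall u, exists v, f (x *: u) = y *: v) ->
  exists g : {linear quot1 M x -> quot1 N y}, forall u, g (pi1 M x u) = pi1 N y (f u).
Proof.
move=> f_xy; have [u /pi1_eq0[v ->]|g gE] :=
    factor_surjection (f := [the {linear _ -> _} of pi1 N y \o f]) (@pi1_surj _ M x).
  by apply/pi1_eq0; exact: f_xy.
by exists g.
Qed.

Lemma short_exact_quot1 x (A B C : lmodType R)
    (i : {linear A -> B}) (p : {linear B -> C}) :
  short_exact i p -> injective (scalm C x) ->
  exists (i' : {linear quot1 A x -> quot1 B x}) (p' : {linear quot1 B x -> quot1 C x}),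
    short_exact i' p'.
Proof.
move=> [i_inj p_surj pi ip] x_inj.
have [u|i' i'E] := @pi1_map_exists _ _ x x i; first by exists (i u); rewrite linearZ.
have [u|p' p'E] := @pi1_map_exists _ _ x x p; first by exists (p u); rewrite linearZ.
exists i', p'; split.
- move=> q r; have [u <-] := pi1_surj q; have [v <-] := pi1_surj r => uv.
  apply/eqP; rewrite -subr_eq0 -linearB; apply/eqP/pi1_eq0.
  have /pi1_eq0[b ib] : pi1 B x (i (u - v)) = 0.
    by rewrite -i'E !linearB uv subrr.
  have /ip[a ab] : p b = 0.
    by apply: x_inj; rewrite linear0 /= -linearZ -ib pi.
  by exists a; apply: i_inj; rewrite ib -ab linearZ.
- move=> q; have [c <-] := pi1_surj q; have [b <-] := p_surj c.
  by exists (pi1 B x b).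
- by move=> q; have [a <-] := pi1_surj q; rewrite i'E p'E pi linear0.
- move=> q; have [b <-] := pi1_surj q; rewrite p'E => /pi1_eq0[c pb].
  have [b' b'c] := p_surj c.
  have /ip[a ab] : p (b - x *: b') = 0 by rewrite linearB linearZ b'c pb subrr.
  exists (pi1 A x a); rewrite i'E ab linearB.
  have -> : pi1 B x (x *: b') = 0 by apply/pi1_eq0; exists b'.
  exact: subr0.
Qed.

(** Regularity passes to extensions: an exact sequence stays exact after
    reduction modulo an element regular on its third term. *)
Lemma weakly_regular_mid xs (A B C : lmodType R)
    (i : {linear A -> B}) (p : {linear B -> C}) :
  short_exact i p -> weakly_regular xs A -> weakly_regular xs C ->
  weakly_regular xs B.
Proof.
elim: xs A B C i p => //= x xs IH A B C i p exact_ip [xA xsA] [xC xsC].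
have [i_inj _ _ ip] := exact_ip; split.
  move=> u v xuv; apply/eqP; rewrite -subr_eq0; apply/eqP.
  have xuv0 : x *: (u - v) = 0.
    by rewrite scalerBr; apply/eqP; rewrite subr_eq0; apply/eqP.
  have /ip[a ab] : p (u - v) = 0.
    by apply: xC; rewrite linear0 /= -linearZ xuv0 linear0.
  suff a0 : a = 0 by rewrite -ab a0 linear0.
  by apply: xA; rewrite linear0; apply: i_inj; rewrite linear0 linearZ ab.
have [i' [p' exact_ip']] := short_exact_quot1 exact_ip xC.
exact: IH exact_ip' xsA xsC.
Qed.

Lemma short_exact_mul M x y : injective (scalm M x) ->
  exists (i : {linear quot1 M y -> quot1 M (x * y)})
         (p : {linear quot1 M (x * y) -> quot1 M x}), short_exact i p.
Proof.
move=> x_inj.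
have [u|i iE] := @pi1_map_exists _ _ y (x * y) (scalm M x).
  by exists u; rewrite /= scalerA.
have [u|p pE] := @pi1_map_exists _ _ (x * y) x (idfun : {linear M -> M}).
  by exists (y *: u); rewrite /= scalerA.
exists i, p; split.
- move=> q r; have [u <-] := pi1_surj q; have [v <-] := pi1_surj r => uv.
  apply/eqP; rewrite -subr_eq0 -linearB; apply/eqP/pi1_eq0.
  have /pi1_eq0[w xw] : pi1 M (x * y) (scalm M x (u - v)) = 0.
    by rewrite -iE !linearB uv subrr.
  by exists w; apply: x_inj; rewrite xw /= scalerA.
- by move=> q; have [u <-] := pi1_surj q; exists (pi1 M (x * y) u).
- by move=> q; have [u <-] := pi1_surj q; rewrite iE pE; apply/pi1_eq0; exists u.
- move=> q; have [u <-] := pi1_surj q; rewrite pE => /pi1_eq0[v /= ->].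
  by exists (pi1 M y v).
Qed.

Lemma injective_scalm_exp M x n : injective (scalm M x) -> injective (scalm M (x ^+ n)).
Proof.
move=> x_inj; elim: n => [|n IH] u v /=; first by rewrite !scale1r.
by rewrite exprS -!scalerA => /x_inj /IH.
Qed.

Lemma weakly_regular_quot1_exp xs M x n : injective (scalm M x) ->
  weakly_regular xs (quot1 M x) -> weakly_regular xs (quot1 M (x ^+ n.+1)).
Proof.
move=> x_inj xs_reg; elim: n => [|n IH]; first by rewrite expr1.
have [i [p exact_ip]] := short_exact_mul (x ^+ n.+1) x_inj.
by rewrite exprS; exact: weakly_regular_mid exact_ip IH xs_reg.
Qed.

(** Powers of a regular sequence form a regular sequence: [M / x ^+ n.+1 M] is
    an iterated extension of copies of [M / x M]. *)
Lemma weakly_regular_pow xs M n :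
  weakly_regular xs M -> weakly_regular (pow_seq xs n.+1) M.
Proof.
elim: xs M => //= x xs IH M [x_inj xs_reg]; split.
  exact: injective_scalm_exp.
by apply: IH; exact: weakly_regular_quot1_exp.
Qed.

End RegularSequences.

(** * The isomorphisms as iterated connecting homomorphisms *)

Section IteratedConnecting.
Variables (R : comNzRingType) (m : {pred R}).
Implicit Types (M N Q : lmodType R) (xs : seq R).

(** A relation rather than a function, because connecting maps exist only for
    regular elements and are not canonically chosen; naturality compares any
    two related maps.  The target [Q] is any quotient of [M] by the powers
    [x ^+ n], which spares the isomorphisms between iterated quotients. *)
Fixpoint iterated_connecting n e xs M Q (q : {linear M -> Q}) :
    {linear local_cohomology m e Q -> local_cohomology m (size xs + e) M} -> Prop :=
  match xs return
    {linear local_cohomology m e Q -> local_cohomology m (size xs + e) M} -> Prop with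
  | [::] => fun f => cancel (local_cohomology_map m e q) f /\
                     cancel f (local_cohomology_map m e q)
  | x :: xs' => fun f => exists (q' : {linear quot1 M (x ^+ n) -> Q})
      (delta : {linear local_cohomology m (size xs' + e) (quot1 M (x ^+ n)) ->
                       local_cohomology m (size xs' + e).+1 M})
      (g : {linear local_cohomology m e Q ->
                   local_cohomology m (size xs' + e) (quot1 M (x ^+ n))}),
      [/\ forall u, q' (pi1 M (x ^+ n) u) = q u,
          connecting (scalm M (x ^+ n)) (pi1 M (x ^+ n)) delta,
          iterated_connecting n q' g & forall u, f u = delta (g u)]
  end.

Lemma iterated_connecting_exists n e xs M Q (q : {linear M -> Q}) :
  weakly_regular (pow_seq xs n) M -> (forall v, exists u, q u = v) ->
  (forall u, (q u == 0) = (u \in ideal_smul M (pow_seq xs n))) ->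
  exists f, @iterated_connecting n e xs M Q q f.
Proof.
elim: xs M q => [|x xs IH] M q xs_reg q_surj q_ker.
  have [u /eqP|g gE] := factor_surjection (f := (idfun : {linear M -> M})) q_surj.
    by rewrite q_ker => /ideal_smul_nil.
  exists (local_cohomology_map m e g); split=> c.
    rewrite -(local_cohomology_map_comp (h := idfun : {linear M -> M})) => [|u].
      exact: local_cohomology_map_id.
    by rewrite gE.
  rewrite -(local_cohomology_map_comp (h := idfun : {linear Q -> Q})) => [|v].
    exact: local_cohomology_map_id.
  by have [u <-] := q_surj v; rewrite gE.
have [x_inj {}xs_reg] := xs_reg.
have [u /pi1_eq0[v ->]|q' q'E] := factor_surjection (f := q) (@pi1_surj _ M (x ^+ n)).
  by apply/eqP; rewrite q_ker; apply: ideal_smul_mem; exact: mem_head.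
have [|u|g gP] := IH _ q' xs_reg.
- by move=> v; have [u <-] := q_surj v; exists (pi1 M (x ^+ n) u).
- by have [v <-] := pi1_surj u; rewrite q'E q_ker ideal_smul_pi1.
have [delta dP] := connecting_exists m (size xs + e) (short_exact_scalm x_inj).
by exists [the {linear _ -> _} of delta \o g], q', delta, g.
Qed.

(** Below degree [size xs + e] there is no cohomology, so each connecting map is
    injective; its image is the kernel of [x ^+ n] by exactness. *)
Lemma iterated_connecting_bij n e xs M Q (q : {linear M -> Q}) f :
  iterated_connecting n q f -> weakly_regular (pow_seq xs n) M ->
  (forall k, (k < size xs + e)%N -> lc_zero m k M) ->
  injective f /\
  forall c, c \in annihilated (local_cohomology m (size xs + e) M) (pow_seq xs n) <->
    exists u, f u = c.
Proof.
elim: xs M q f => [|x xs IH] M q f.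
  move=> [fK Kf] _ _; split; first exact: can_inj Kf.
  by move=> c; split=> // _; exists (local_cohomology_map m e q c); exact: fK.
move=> [q' [delta [g [q'E dP gP fE]]]] [x_inj xs_reg] M0.
have exact_x := short_exact_scalm x_inj.
have [g_inj g_im] := IH _ _ _ gP xs_reg (lc_zero_quot1_lt x_inj M0).
have delta_inj c : delta c = 0 -> c = 0.
  move=> /(connecting_ker exact_x dP)[b <-].
  by rewrite (M0 (size xs + e)%N (ltnSn _) b) linear0.
split=> [u v|c].
  rewrite !fE => /eqP; rewrite -subr_eq0 -linearB => /eqP /delta_inj /eqP.
  by rewrite subr_eq0 => /eqP /g_inj.
split=> [/andP[/eqP xc /allP xsc]|[u <-]].
  have [c' c'E] : exists c', delta c' = c.
    by apply: (connecting_im exact_x dP); rewrite local_cohomology_scalm.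
  have /g_im[u uE] : c' \in annihilated _ (pow_seq xs n).
    apply/allP => y yxs; apply/eqP/delta_inj; rewrite linearZ c'E.
    exact/eqP/xsc.
  by exists u; rewrite fE uE.
apply/andP; rewrite fE -local_cohomology_scalm (map_connecting exact_x dP); split=> //.
have /g_im /allP gu : exists v, g v = g u by exists u.
by apply/allP => y /gu /eqP yu; rewrite -linearZ yu linear0.
Qed.

(** Raising the exponent multiplies by one more factor [x]: multiplication by
    [x ^+ n.+1] maps to multiplication by [x ^+ n] through [x] on the source
    and the identity on the target, and connecting maps are natural. *)
Lemma iterated_connecting_natural n e xs M M' Q Q' (q : {linear M -> Q})
    (q' : {linear M' -> Q'}) f f' (F : {linear M -> M'}) (G : {linear Q -> Q'}) :
  weakly_regular (pow_seq xs n.+1) M ->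
  @iterated_connecting n.+1 e xs M Q q f -> @iterated_connecting n e xs M' Q' q' f' ->
  (forall u, G (q u) = q' (F u)) ->
  forall c, f' (local_cohomology_map m e G c) =
    (\prod_(y <- xs) y) *: local_cohomology_map m (size xs + e) F (f c).
Proof.
elim: xs M M' q q' f f' F => [|x xs IH] M M' q q' f f' F.
  move=> _ [fK Kf] [f'K Kf'] Gq c; rewrite big_nil scale1r.
  rewrite -[RHS]f'K; congr (f' _); rewrite -{1}[c]Kf.
  pose h := [the {linear _ -> _} of G \o q].
  by rewrite -!(local_cohomology_map_comp (h := h)).
move=> [x_inj xs_reg] [q1 [delta [g [q1E dP gP fE]]]].
move=> [q1' [delta' [g' [q1'E d'P g'P f'E]]]] Gq c.
have [u|F1 F1E] := @pi1_map_exists _ _ _ (x ^+ n.+1) (x ^+ n) F.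
  by exists (x *: F u); rewrite linearZ scalerA -exprSr.
rewrite f'E (IH _ _ _ _ _ _ F1 xs_reg gP g'P); last first.
  by move=> u; have [v <-] := pi1_surj u; rewrite q1E F1E q1'E.
rewrite linearZ big_cons fE mulrC -scalerA; congr (_ *: _).
pose xF : {linear M -> M'} := x \*: F.
have xFE : forall u, F (scalm M (x ^+ n.+1) u) = scalm M' (x ^+ n) (xF u).
  by move=> u; rewrite /xF /= linearZ scalerA -exprSr.
rewrite (connecting_natural (short_exact_scalm x_inj) xFE F1E _ dP d'P).
by apply: local_cohomology_map_scale.
Qed.

End IteratedConnecting.

Section Coregular.
Variables (R : comNzRingType) (m : {pred R}).
Hypotheses (R_noetherian : noetherian_ring R) (m_ideal : is_ideal m).

(** The first element [x] acts surjectively because [H^D(M / x M)] vanishes for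
    reasons of dimension; the others act on the kernel of [x] as they do on
    [H^(D-1)(M / x M)], through the connecting map. *)
Lemma coregular_local_cohomology D (xs : seq R) (M : lmodType R) :
  finitely_generated M -> dim_lt M D.+1 ->
  (forall k, (k < D)%N -> lc_zero m k M) -> weakly_regular xs M ->
  (size xs <= D)%N -> coregular_seq (local_cohomology m D M) xs.
Proof.
elim: xs D M => // x xs IH D M M_fg M_dim M0 [x_inj xs_reg] xs_D.
have exact_x := short_exact_scalm x_inj.
have Q_dim := dim_lt_quot1 R_noetherian x_inj M_dim.
have Q_fg : finitely_generated (quot1 M x) by exact: finitely_generated_quot.
case=> [_ v _|j j_lt v].
  have QD : lc_zero m D (quot1 M x) by exact: lc_zero_dim Q_dim _.
  have [u <-] := local_cohomology_exact exact_x (QD (local_cohomology_map m D (pi1 M x) v)).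
  by exists u => //; rewrite local_cohomology_scalm.
case: D M_dim M0 xs_D Q_dim v => // D M_dim M0 xs_D Q_dim v.
have [delta dP] := connecting_exists m D exact_x.
have delta_inj c : delta c = 0 -> c = 0.
  move=> /(connecting_ker exact_x dP)[b <-].
  by rewrite (M0 D (ltnSn _) b) linear0.
move=> /andP[/eqP xv /allP xsv].
have [w wv] : exists w, delta w = v.
  by apply: (connecting_im exact_x dP); rewrite local_cohomology_scalm.
have [|w' w'_ann w'w] := IH D _ Q_fg Q_dim (lc_zero_quot1_lt x_inj M0) xs_reg xs_D j j_lt w.
  apply/allP => y yxs; apply/eqP/delta_inj; rewrite linearZ wv.
  exact/eqP/xsv.
exists (delta w'); last by rewrite -linearZ w'w.
apply/andP; rewrite -local_cohomology_scalm (map_connecting exact_x dP); split=> //.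
apply/allP => y yxs; rewrite -linearZ.
by move/allP: w'_ann => /(_ y yxs)/eqP ->; rewrite linear0.
Qed.

End Coregular.

Section Isomorphisms.
Variables (R : comNzRingType) (m : {pred R}).

Lemma annihilator_isomorphisms e D (xs : seq R) (M : lmodType R) :
  (size xs + e)%N = D -> weakly_regular xs M ->
  (forall k, (k < D)%N -> lc_zero m k M) ->
  exists alpha : forall n : nat,
      {linear local_cohomology m e (quot_seq M (pow_seq xs n)) ->
              ann_seq (local_cohomology m D M) (pow_seq xs n)},
    (forall n : nat, (1 <= n)%N -> bijective (alpha n)) /\
    (forall n : nat, (1 <= n)%N ->
       forall z : local_cohomology m e (quot_seq M (pow_seq xs n.+1)),
         alpha n (local_cohomology_map m e (quot_pow_surj M xs n) z) =
         ann_mul (local_cohomology m D M) xs n (alpha n.+1 z)).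
Proof.
move=> <- {D} xs_reg M0.
pose q n : {linear M -> quot_seq M (pow_seq xs n)} :=
  qpi (ideal_smul M (pow_seq xs n) : submodClosed M).
have ex n : exists a : {linear local_cohomology m e (quot_seq M (pow_seq xs n)) ->
      ann_seq (local_cohomology m (size xs + e) M) (pow_seq xs n)},
    (1 <= n)%N -> bijective a /\
      exists2 f, iterated_connecting n (q n) f & forall c, smval (a c) = f c.
  (* Nothing is claimed at [n = 0], where any map will do. *)
  case: n => [|n]; first by exists \0.
  have pow_reg := weakly_regular_pow n xs_reg.
  have [v|u|f fP] := @iterated_connecting_exists _ m _ e _ _ _ (q n.+1) pow_reg.
  - by have [u ->] := qpi_surj v; exists u.
  - exact: qpi_eq0.
  have [f_inj f_im] := iterated_connecting_bij fP pow_reg M0.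
  have fS c : f c \in annihilated _ (pow_seq xs n.+1) by apply/f_im; exists c.
  exists (corestr fS) => _; split; last by exists f.
  have pre (v : ann_seq (local_cohomology m (size xs + e) M) (pow_seq xs n.+1)) :
      exists u, f u = smval v by apply/f_im; exact: smP.
  exists (fun v => projT1 (cid (pre v))) => c.
    by apply: f_inj; exact: (projT2 (cid (pre (corestr fS c)))).
  by apply: val_inj; exact: (projT2 (cid (pre c))).
exists (fun n => projT1 (cid (ex n))); split=> n n_gt0.
  by have [] := projT2 (cid (ex n)) n_gt0.
move=> z; apply: val_inj; rewrite [RHS]ann_mulE.
have [_ [f fP fE]] := projT2 (cid (ex n)) n_gt0.
have [_ [f' f'P f'E]] := projT2 (cid (ex n.+1)) isT.
rewrite [LHS]fE f'E.
rewrite (iterated_connecting_natural (weakly_regular_pow n xs_reg) f'P fP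
           (F := idfun : {linear M -> M})).
  by congr (_ *: _); exact: local_cohomology_map_id.
by move=> u; exact: quot_pow_surjE.
Qed.

End Isomorphisms.

Theorem proposition2p1 (R : comNzRingType) (m : {pred R}) (M : lmodType R)
    (d i : nat) (x : i.-tuple R)
    (R_noetherian : noetherian_ring R) (R_local : local_ring m)
    (M_CM : cohen_macaulay m M) (M_dim : krull_dim M d)
    (x_m : {subset x <= m}) (x_regular : regular_seq M x) :
  coregular_seq (local_cohomology m d M) x /\
  exists alpha : forall n : nat,
      {linear local_cohomology m (d - i) (quot_seq M (pow_seq x n)) ->
              ann_seq (local_cohomology m d M) (pow_seq x n)},
    (forall n : nat, (1 <= n)%N -> bijective (alpha n)) /\
    (forall n : nat, (1 <= n)%N ->
       forall z : local_cohomology m (d - i) (quot_seq M (pow_seq x n.+1)),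
         alpha n (local_cohomology_map m (d - i) (quot_pow_surj M x n) z) =
         ann_mul (local_cohomology m d M) x n (alpha n.+1 z)).
Proof.
have [M_fg [d' M_dim' [[ys [ys_m ys_reg ys_size]] depth_max]]] := M_CM.
have dd' : d' = d.
  have [[p pP] p_max] := M_dim; have [[p' p'P] p'_max] := M_dim'.
  by apply/eqP; rewrite eqn_leq (p_max _ _ p'P) (p'_max _ _ pP).
rewrite {}dd' in ys_size depth_max.
have x_d : (size x <= d)%N by exact: depth_max.
have x_reg := regular_weakly_regular x_regular.
have M0 k : (k < d)%N -> lc_zero m k M.
  rewrite -ys_size; apply: lc_zero_weakly_regular => //.
  exact: regular_weakly_regular.
split.
  have m_ideal : is_ideal m by case: R_local => -[/idealr_is_ideal].
  by apply: coregular_local_cohomology => // p l /M_dim.2; rewrite ltnS.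
by apply: annihilator_isomorphisms => //; rewrite size_tuple subnKC // -(size_tuple x).
Qed.
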